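(* Let $\mathcal{X},\mathcal{Y}$ be Hilbert modules over a pro-$C^*$-algebra $\mathcal{A}$ and let $T\in Hom^*_{\mathcal{A}}(\mathcal{X},\mathcal{Y})$. Then the following are equivalent: (1) $T$ has a bounded generalized inverse module map $T^\dagger\in Hom^*_{\mathcal{A}}(\mathcal{Y},\mathcal{X})$; (2) $Ran(T)$ is a closed submodule of $\mathcal{Y}$.
   Context: A pro-$C^*$-algebra $\mathcal{A}$ is a complete Hausdorff topological $*$-algebra whose topology is given by its continuous $C^*$-seminorms $S(\mathcal{A})$. A Hilbert $\mathcal{A}$-module is a left $\mathcal{A}$-module with an $\mathcal{A}$-valued inner product, complete for the seminorms $\bar p(\xi)=\sqrt{p(\langle\xi,\xi\rangle)}$, $p\in S(\mathcal{A})$. $Hom^*_{\mathcal{A}}(\mathcal{X},\mathcal{Y})$ denotes the adjointable bounded $\mathcal{A}$-module maps $\mathcal{X}\to\mathcal{Y}$. A bounded generalized inverse module map of $T$ is an operator $T^\dagger\in Hom^*_{\mathcal{A}}(\mathcal{Y},\mathcal{X})$ such that $TT^\dagger T=T$, $T^\dagger TT^\dagger=T^\dagger$, $(TT^\dagger)^*=TT^\dagger$ and $(T^\dagger T)^*=T^\dagger T$. *)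

(* Defs.v *)
From mathcomp Require Import all_boot all_algebra.
From mathcomp Require Import complex reals.
From Stdlib Require List.
Set Implicit Arguments. Unset Strict Implicit. Unset Printing Implicit Defensive.
Import GRing.Theory Num.Theory.
Local Open Scope ring_scope.
Local Open Scope complex_scope.

Section ProCstar.
Variable R : realType.
Local Notation C := R[i].

Definition star_algebra (A : lmodType C) (mul : A -> A -> A) (star : A -> A) :=
  [/\ (forall a b c, mul a (mul b c) = mul (mul a b) c),
      (forall a b c, mul a (b + c) = mul a b + mul a c),
      (forall a b c, mul (a + b) c = mul a c + mul b c),
      (forall (k : C) a b, mul (k *: a) b = k *: mul a b /\ mul a (k *: b) = k *: mul a b) &
   [/\ (forall a, star (star a) = a),
      (forall a b, star (a + b) = star a + star b),
      (forall (k : C) a, star (k *: a) = k^* *: star a) &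
      (forall a b, star (mul a b) = mul (star b) (star a))]].

Definition Cstar_seminorm (A : lmodType C) (mul : A -> A -> A) (star : A -> A)
    (p : A -> R) :=
  [/\ (forall a, 0 <= p a),
      (forall a b, p (a + b) <= p a + p b),
      (forall (k : C) a, (p (k *: a))%:C = `|k| * (p a)%:C),
      (forall a b, p (mul a b) <= p a * p b) &
      (forall a, p (mul (star a) a) = p a ^+ 2)].

(* The topology on a vector space V generated by a family S of seminorms:
   basic neighbourhoods of x are {y | forall p in F, p (y - x) < e}, for a
   finite F (a list) of members of S and e > 0. *)
Definition in_family (V : lmodType C) (S : (V -> R) -> Prop) (F : seq (V -> R)) :=
  forall p, List.In p F -> S p.

Definition basic_nbhs (V : lmodType C) (F : seq (V -> R)) (e : R) (x y : V) :=
  forall p, List.In p F -> p (y - x) < e.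

Definition gen_continuous (V : lmodType C) (S : (V -> R) -> Prop) (f : V -> R) :=
  forall x (eps : R), 0 < eps -> exists F (d : R),
    [/\ in_family S F, 0 < d &
        forall y, basic_nbhs F d x y -> `|f y - f x| < eps].

Definition gen_hausdorff (V : lmodType C) (S : (V -> R) -> Prop) :=
  forall x : V, (forall p, S p -> p x = 0) -> x = 0.

Definition gen_complete (V : lmodType C) (S : (V -> R) -> Prop) :=
  forall (D : Type) (le : D -> D -> Prop) (d0 : D) (x : D -> V),
    (forall d, le d d) -> (forall a b c, le a b -> le b c -> le a c) ->
    (forall a b, exists c, le a c /\ le b c) ->
    (forall F (eps : R), in_family S F -> 0 < eps -> exists d1,
        forall d2 d3, le d1 d2 -> le d1 d3 -> basic_nbhs F eps (x d2) (x d3)) ->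
    exists l : V, forall F (eps : R), in_family S F -> 0 < eps ->
      exists d1, forall d2, le d1 d2 -> basic_nbhs F eps l (x d2).

Definition gen_closed (V : lmodType C) (S : (V -> R) -> Prop) (M : V -> Prop) :=
  forall y : V,
    (forall F (eps : R), in_family S F -> 0 < eps ->
        exists2 z, M z & basic_nbhs F eps y z) -> M y.

(* sems is S(A), the set of continuous C*-seminorms, and the topology of A is
   the one generated by S(A). *)
Record proCstar := ProCstar {
  pc_car :> lmodType C;
  pc_mul : pc_car -> pc_car -> pc_car;
  pc_star : pc_car -> pc_car;
  pc_sems : (pc_car -> R) -> Prop;
  pc_staralg : star_algebra pc_mul pc_star;
  pc_semsP : forall p, pc_sems p <->
      (Cstar_seminorm pc_mul pc_star p /\ gen_continuous pc_sems p);
  pc_hausdorff : gen_hausdorff pc_sems;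
  pc_complete : gen_complete pc_sems
}.

Definition positive (A : proCstar) (a : A) :=
  exists b : A, a = pc_mul (pc_star b) b.

Record hilbert_module (A : proCstar) := HilbertModule {
  hm_car :> lmodType C;
  hm_act : A -> hm_car -> hm_car;
  hm_ip : hm_car -> hm_car -> A;
  hm_act_mul : forall a b x, hm_act (pc_mul a b) x = hm_act a (hm_act b x);
  hm_act_addl : forall a b x, hm_act (a + b) x = hm_act a x + hm_act b x;
  hm_act_addr : forall a x y, hm_act a (x + y) = hm_act a x + hm_act a y;
  hm_act_scale : forall (k : C) a x,
      hm_act (k *: a) x = k *: hm_act a x /\ hm_act a (k *: x) = k *: hm_act a x;
  hm_ip_addl : forall x y z, hm_ip (x + y) z = hm_ip x z + hm_ip y z;
  hm_ip_scale : forall (k : C) x y, hm_ip (k *: x) y = k *: hm_ip x y;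
  hm_ip_act : forall a x y, hm_ip (hm_act a x) y = pc_mul a (hm_ip x y);
  hm_ip_sym : forall x y, hm_ip y x = pc_star (hm_ip x y);
  hm_ip_pos : forall x, positive (hm_ip x x);
  hm_ip_def : forall x, hm_ip x x = 0 -> x = 0;
  hm_complete : gen_complete (fun q : hm_car -> R =>
      exists2 p, pc_sems p & q = (fun x => Num.sqrt (p (hm_ip x x))))
}.

Arguments hm_act {A} _.
Arguments hm_ip {A} _.

Definition hm_sems (A : proCstar) (X : hilbert_module A) : (X -> R) -> Prop :=
  fun q => exists2 p, pc_sems p & q = (fun x => Num.sqrt (p (hm_ip X x x))).

Definition pbar (A : proCstar) (X : hilbert_module A) (p : A -> R) (x : X) : R :=
  Num.sqrt (p (hm_ip X x x)).

Arguments pbar {A} X p x.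
Arguments hm_sems {A} X _.

Definition module_map (A : proCstar) (X Y : hilbert_module A) (T : X -> Y) :=
  [/\ (forall x y, T (x + y) = T x + T y),
      (forall (k : C) x, T (k *: x) = k *: T x) &
      (forall a x, T (hm_act X a x) = hm_act Y a (T x))].

Definition bounded_map (A : proCstar) (X Y : hilbert_module A) (T : X -> Y) :=
  forall p, pc_sems p -> exists2 c : R, 0 <= c &
    forall x, pbar Y p (T x) <= c * pbar X p x.

Definition is_adjoint (A : proCstar) (X Y : hilbert_module A)
    (T : X -> Y) (Ts : Y -> X) :=
  forall x y, hm_ip Y (T x) y = hm_ip X x (Ts y).

Definition Hom_star (A : proCstar) (X Y : hilbert_module A) (T : X -> Y) :=
  [/\ module_map T, bounded_map T & exists Ts : Y -> X, is_adjoint T Ts].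

Definition self_adjoint (A : proCstar) (X : hilbert_module A) (S : X -> X) :=
  is_adjoint S S.

Definition bounded_ginv (A : proCstar) (X Y : hilbert_module A)
    (T : X -> Y) (Td : Y -> X) :=
  [/\ Hom_star Td,
      (forall x, T (Td (T x)) = T x),
      (forall y, Td (T (Td y)) = Td y),
      self_adjoint (fun y => T (Td y)) &
      self_adjoint (fun x => Td (T x))].

Definition ran (A : proCstar) (X Y : hilbert_module A) (T : X -> Y) : Y -> Prop :=
  fun y => exists x, y = T x.

Definition submodule (A : proCstar) (Y : hilbert_module A) (M : Y -> Prop) :=
  [/\ M 0, (forall y z, M y -> M z -> M (y + z)),
      (forall (k : C) y, M y -> M (k *: y)) &
      (forall a y, M y -> M (hm_act Y a y))].

Definition closed_submodule (A : proCstar) (Y : hilbert_module A) (M : Y -> Prop) :=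
  submodule M /\ gen_closed (hm_sems Y) M.

End ProCstar.

(* Main.v *)
(* If [T] has a generalized inverse [T'] then [T T'] is a continuous projection
   onto [Ran T].  For the converse, [S = T T^*] restricted to the closed module
   [M = Ran T] is shown to be bounded below for each seminorm [p].  The open mapping
   theorem is not available (the topology need not be metrizable), but if the bound
   failed for some [p] there would be [z_k] in [M] with [p(z_k)] of order one and
   [p(T^* z_k)] tiny; replacing [z_k] by [(1 + <z_k, z_k>)^-1 z_k] makes the sequence
   bounded for all seminorms simultaneously, so that a gliding hump
   [sum +-8^-k z_k] converges in [M] to some [T x], and pairing with [z_k] gives a
   contradiction.  Being bounded below, [S] is bijective on [M] by the continuity
   method, and [T^* S^-1 P], with [P] the projection [S^-1 T T^*], is the inverse.

   All estimates rest on one fact on C*-seminorms, [p(b^* b) <= p(b^* b + c^* c)],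
   from which the Cauchy-Schwarz inequality follows.  It amounts to the positivity of
   [b^* b], proved without functional calculus: positivity of [h] is the condition
   [p(r - h) <= r], and square roots of positive elements are approximated by
   polynomials. *)
Require Import Defs.
From HB Require Import structures.
From mathcomp Require Import all_boot all_order all_algebra.
From mathcomp Require Import complex boolp classical_sets reals ring lra.
Set Implicit Arguments. Unset Strict Implicit. Unset Printing Implicit Defensive.
Import Order.TTheory GRing.Theory Num.Theory.
Local Open Scope ring_scope.
Local Open Scope complex_scope.

(** * Positivity in unital C*-seminormed algebras *)

Section UnitalCstarSeminorm.
Variables (R : realType) (B : algType R) (st : B -> B) (I : B) (p : B -> R).
Hypotheses (stK : involutive st) (stD : forall x y, st (x + y) = st x + st y)
  (stZ : forall (r : R) x, st (r *: x) = r *: st x)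
  (stM : forall x y, st (x * y) = st y * st x).
Hypotheses (p_ge0 : forall x, 0 <= p x) (pD : forall x y, p (x + y) <= p x + p y)
  (pZ : forall (r : R) x, p (r *: x) = `|r| * p x)
  (pM : forall x y, p (x * y) <= p x * p y)
  (pC : forall x, p (st x * x) = p x ^+ 2).
Hypotheses (II : I * I = - 1) (Icomm : forall x, I * x = x * I) (stI : st I = - I).

Local Notation sa x := (st x = x).

Lemma st0 : st 0 = 0.
Proof. by have := stZ 0 0; rewrite !scale0r. Qed.

Lemma stN x : st (- x) = - st x.
Proof. by rewrite -scaleN1r stZ scaleN1r. Qed.

Lemma stB x y : st (x - y) = st x - st y.
Proof. by rewrite stD stN. Qed.

Lemma st1 : st 1 = 1.
Proof. by have := congr1 st (mulr1 (st 1)); rewrite stM stK mulr1. Qed.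

Lemma stX x n : sa x -> sa (x ^+ n).
Proof. by move=> hx; elim: n => [|n IHn]; rewrite ?st1 // exprS stM hx IHn -exprSr -exprS. Qed.

Lemma st_scalar r : st r%:A = r%:A.
Proof. by rewrite stZ st1. Qed.

Lemma p0 : p 0 = 0.
Proof. by have := pZ 0 0; rewrite scale0r normr0 mul0r. Qed.

Lemma pN x : p (- x) = p x.
Proof. by rewrite -scaleN1r pZ normrN1 mul1r. Qed.

Lemma p_distC x y : p (x - y) = p (y - x).
Proof. by rewrite -pN opprB. Qed.

(** The C*-identity makes [p 1] equal to its own square; the value [0] occurs for [p = 0]. *)
Lemma p1_le1 : p 1 <= 1.
Proof.
have := pC 1; rewrite st1 mulr1 expr2 => h.
have [->//|p1n0] := eqVneq (p 1) 0.
by rewrite -(mulfI p1n0 (etrans (mulr1 _) h)).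
Qed.

Lemma p_scalar r : p r%:A <= `|r|.
Proof. by rewrite pZ -[leRHS]mulr1 ler_wpM2l // p1_le1. Qed.

Lemma p_st x : p (st x) = p x.
Proof.
have half y : p y <= p (st y).
  have [->|yn0] := eqVneq (p y) 0; first exact: p_ge0.
  have y0 : 0 < p y by rewrite lt_def yn0 p_ge0.
  by rewrite -(ler_pM2r y0) -expr2 -pC pM.
by apply/eqP; rewrite eq_le -{2}(stK x) !half.
Qed.

Lemma p_sa x : sa x -> p (x * x) = p x ^+ 2.
Proof. by move=> hx; rewrite -pC hx. Qed.

(* [u] is the real part of the normal element [u + I v], and
   [(u + I v)^* (u + I v) = u^2 + v^2]. *)
Lemma p_sqr_le_sum u v : sa u -> sa v -> GRing.comm u v ->
  p u ^+ 2 <= p (u * u + v * v).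
Proof.
move=> hu hv uv; pose x := u + I * v.
have stx : st x = u - I * v by rewrite stD stM hu hv stI mulrN Icomm.
have xx : st x * x = u * u + v * v.
  rewrite stx mulrDr mulrBl mulrBl -(mulrA I v (I * v)) (mulrA v) -(Icomm v).
  rewrite -(mulrA I v v) (mulrA I I) II mulN1r opprK.
  by rewrite -(mulrA I) -uv (mulrA I) (Icomm u) mulrA addrA subrK.
rewrite -xx pC ler_pXn2r ?nnegrE //.
have : p (x + st x) <= p x + p (st x) by [].
have -> : x + st x = 2 *: u by rewrite stx addrACA subrr addr0 scaler_nat mulr2n.
by rewrite pZ p_st ger0_norm //; lra.
Qed.

(* A fixed point [y] of [y |-> (x + y^2) / 2] satisfies [(1 - y)^2 = 1 - x]; the
   scalar iterates at [x = 1] majorize the vector ones. *)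
Fixpoint sqrt_seq (x : B) n : B :=
  if n is n'.+1 then 2^-1 *: (x + sqrt_seq x n' * sqrt_seq x n') else 0.

Fixpoint sqrt_majorant n : R :=
  if n is n'.+1 then (1 + sqrt_majorant n' ^+ 2) / 2 else 0.

Lemma sqrt_majorant_bounds n : 0 <= sqrt_majorant n <= 1.
Proof. by elim: n => /= [|n /andP[h0 h1]]; [lra|apply/andP; split; nra]. Qed.

(* Each step decreases [d = 1 - sqrt_majorant] by [d^2 / 2], so [d <= e] after
   about [2 / e^2] steps. *)
Lemma sqrt_majorant_cvg (e : R) : 0 < e -> exists n, 1 - sqrt_majorant n <= e.
Proof.
move=> e0; apply: contrapT => /forallNP h.
have lt n : e < 1 - sqrt_majorant n by rewrite ltNge; apply/negP/h.
have lin n : n%:R * (e ^+ 2 / 2) <= sqrt_majorant n.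
  elim: n => [|n IHn]; first by rewrite mul0r.
  rewrite -addn1 natrD mulrDl mul1r addn1 /=.
  by have := lt n; have := sqrt_majorant_bounds n; nra.
have e20 : 0 < e ^+ 2 / 2 by nra.
have [k hk] : exists k, (e ^+ 2 / 2)^-1 < k%:R :> R.
  by exists (Num.bound (e ^+ 2 / 2)^-1);
    apply: le_lt_trans (archi_boundP _); rewrite ?ler_norm // ltW ?invr_gt0.
have := lin k; have := sqrt_majorant_bounds k.
have : 1 < k%:R * (e ^+ 2 / 2) by rewrite -ltr_pdivrMr // mul1r.
lra.
Qed.

(** All iterates commute, so an increment is half the previous increment times the sum of two
    consecutive iterates. The scalar increments factor in the same way, which carries the
    majorization through the induction. *)
Lemma sqrt_seqP x n : sa x -> p x <= 1 ->
  [/\ sa (sqrt_seq x n), p (sqrt_seq x n) <= sqrt_majorant n,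
      (forall z, GRing.comm z x -> GRing.comm z (sqrt_seq x n)) &
      p (sqrt_seq x n.+1 - sqrt_seq x n) <= sqrt_majorant n.+1 - sqrt_majorant n].
Proof.
move=> hx px; have half0 : (0 : R) <= 2^-1 by lra.
have ge0 : `|(2^-1 : R)| = 2^-1 by rewrite ger0_norm.
elim: n => [|n [IH1 IH2 IH3 IH4]].
  split; rewrite ?st0 ?p0 //=; first by move=> z _; apply: commr0.
  by rewrite mul0r addr0 subr0 pZ ge0; lra.
have s1 : sa (sqrt_seq x n.+1) by rewrite /= stZ stD stM hx IH1.
have c1 z : GRing.comm z x -> GRing.comm z (sqrt_seq x n.+1).
  move=> zx; rewrite /GRing.comm /= -scalerAr -scalerAl; congr (_ *: _).
  by apply: commrD => //; apply: commrM; apply: IH3.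
have bn := sqrt_majorant_bounds n.
have b1 : p (sqrt_seq x n.+1) <= sqrt_majorant n.+1.
  rewrite /= pZ ge0 mulrC ler_pM2r ?invr_gt0 //.
  apply: le_trans (pD _ _) _; apply: lerD => //.
  by apply: le_trans (pM _ _) _; rewrite expr2 ler_pM.
split => //.
have comm : GRing.comm (sqrt_seq x n.+1) (sqrt_seq x n).
  by apply: IH3; apply/commr_sym/c1.
have -> : sqrt_seq x n.+2 - sqrt_seq x n.+1 =
    2^-1 *: ((sqrt_seq x n.+1 - sqrt_seq x n) * (sqrt_seq x n.+1 + sqrt_seq x n)).
  rewrite {1}/sqrt_seq -/sqrt_seq -/(sqrt_seq x n.+1).
  rewrite {3}/sqrt_seq -/sqrt_seq -scalerBr; congr (_ *: _).
  by rewrite mulrBl !mulrDr comm addrKA opprD addrACA subrr add0r.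
have -> : sqrt_majorant n.+2 - sqrt_majorant n.+1 =
    2^-1 * ((sqrt_majorant n.+1 - sqrt_majorant n) * (sqrt_majorant n.+1 + sqrt_majorant n)).
  by rewrite /=; field.
rewrite pZ ge0 ler_wpM2l //; apply: le_trans (pM _ _) _; apply: ler_pM => //.
by apply: le_trans (pD _ _) _; apply: lerD.
Qed.

(** The error is, up to sign, twice the increment of the iteration at [y], so a finite stage of the
    iteration suffices. *)
Lemma sqrt_approx x e : sa x -> p x <= 1 -> 0 < e ->
  exists y, [/\ sa y, p y <= 1, (forall z, GRing.comm z x -> GRing.comm z y) &
                p (1 - x - (1 - y) * (1 - y)) <= e].
Proof.
(* The error is at most [(1 - m)^2] with [m] the scalar iterate, hence at most [e] once [1 - m] is
   at most both [e] and [1]. *)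
move=> hx px e0; have m0 : 0 < Num.min e 1 by rewrite lt_min e0 ltr01.
have [n hn] := sqrt_majorant_cvg m0.
have [h1 h2 h3 h4] := sqrt_seqP n hx px.
have bn := sqrt_majorant_bounds n.
exists (sqrt_seq x n); split => //; first by lra.
set y := sqrt_seq x n in h1 h2 h3 h4 *.
have -> : 1 - x - (1 - y) * (1 - y) = - (2 *: (sqrt_seq x n.+1 - y)).
  rewrite /= -/y scalerBr scalerA divff ?pnatr_eq0 // scale1r scaler_nat.
  rewrite mulrBl mul1r mulrBr mulr1 mulr2n !opprB opprD (addrACA y) addrCA.
  by rewrite (addrC 1) addrACA (addrC 1) subrK addrC.
rewrite pN pZ ger0_norm //.
have : 2 * p (sqrt_seq x n.+1 - y) <= 2 * (sqrt_majorant n.+1 - sqrt_majorant n).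
  by rewrite ler_pM2l.
move=> h; apply: le_trans h _; rewrite /=.
have : 1 - sqrt_majorant n <= e by rewrite (le_trans hn) // ge_min lexx.
have : 1 - sqrt_majorant n <= 1 by rewrite (le_trans hn) // ge_min lexx orbT.
nra.
Qed.

(* The elements whose spectrum lies in [0, +oo[, described by the norm alone. *)
Definition pos h := sa h /\ exists2 r, 0 <= r & p (r%:A - h) <= r.

Lemma pos_widen h r r' : p (r%:A - h) <= r -> r <= r' -> p (r'%:A - h) <= r'.
Proof.
move=> hr rr'; have -> : r'%:A - h = (r' - r)%:A + (r%:A - h).
  by rewrite scalerBl addrA subrK.
apply: le_trans (pD _ _) _; have := p_scalar (r' - r).
by rewrite ger0_norm ?subr_ge0 //; lra.
Qed.

Lemma posD h k : pos h -> pos k -> pos (h + k).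
Proof.
move=> [sh [r r0 hr]] [sk [t t0 ht]]; split; first by rewrite stD sh sk.
exists (r + t); first by rewrite addr_ge0.
by rewrite scalerDl opprD addrACA; apply: le_trans (pD _ _) _; apply: lerD.
Qed.

Lemma posZ a h : 0 <= a -> pos h -> pos (a *: h).
Proof.
move=> a0 [sh [r r0 hr]]; split; first by rewrite stZ sh.
exists (a * r); first by rewrite mulr_ge0.
by rewrite -scalerA -scalerBr pZ ger0_norm // ler_wpM2l.
Qed.

Lemma pos_scalar a : 0 <= a -> pos a%:A.
Proof. by move=> a0; split; [exact: st_scalar | exists a => //; rewrite subrr p0]. Qed.

Lemma pos_sub_norm s m : sa s -> p s <= m -> pos (m%:A - s).
Proof.
move=> ss sm; split; first by rewrite stB st_scalar ss.
by exists m; [exact: le_trans (p_ge0 s) sm | rewrite opprB addrCA subrr addr0].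
Qed.

(** [1 - h^2] is close to some [k^2] with [k] commuting with [h]; then [k^2 + h^2] is close to [1],
    and [p_sqr_le_sum] bounds [p k ^+ 2]. *)
Lemma p_sub_sqr1 h : sa h -> p h <= 1 -> p (1 - h * h) <= 1.
Proof.
move=> sh ph; apply/ler_addgt0Pr => e e0.
have shh : sa (h * h) by rewrite stM sh.
have phh : p (h * h) <= 1.
  by apply: le_trans (pM _ _) _; rewrite -[leRHS]mulr1; apply: ler_pM.
have [y [sy py cy hy]] := sqrt_approx shh phh (divr_gt0 e0 (ltr0n R 2)).
set k := 1 - y in hy; have sk : sa k by rewrite stB st1 sy.
have hk : GRing.comm k h.
  apply/commr_sym/commrB; first exact: commr1.
  by apply: cy; rewrite /GRing.comm mulrA.
have le1 : p (k * k + h * h) <= 1 + e / 2.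
  have -> : k * k + h * h = 1 - (1 - h * h - k * k).
    by rewrite -addrA -opprD opprB addrCA subrr addr0 addrC.
  by apply: le_trans (pD _ _) _; rewrite pN; apply: lerD => //; exact: p1_le1.
have -> : 1 - h * h = (1 - h * h - k * k) + k * k by rewrite subrK.
apply: le_trans (pD _ _) _; rewrite p_sa //.
by have := p_sqr_le_sum sk sh hk; lra.
Qed.

Lemma p_sub_sqr h s : sa h -> 0 < s -> p h <= s -> p ((s ^+ 2)%:A - h * h) <= s ^+ 2.
Proof.
move=> sh s0 ph; set t := s^-1 *: h.
have st' : sa t by rewrite stZ sh.
have pt : p t <= 1 by rewrite pZ gtr0_norm ?invr_gt0 // mulrC ler_pdivrMr // mul1r.
have -> : (s ^+ 2)%:A - h * h = s ^+ 2 *: (1 - t * t).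
  rewrite scalerBr -scalerAl -scalerAr !scalerA; congr (_ - _).
  by rewrite expr2 mulfK ?gt_eqF // divff ?gt_eqF // scale1r.
rewrite pZ ger0_norm ?sqr_ge0 // -[leRHS]mulr1 ler_wpM2l ?sqr_ge0 //.
exact: p_sub_sqr1.
Qed.

Lemma pos_sqr h : sa h -> pos (h * h).
Proof.
move=> sh; split; first by rewrite stM sh.
exists ((p h + 1) ^+ 2); first exact: sqr_ge0.
by apply: p_sub_sqr => //; have := p_ge0 h; lra.
Qed.

(** From [p (r - h) <= r], the element [x = 1 - h / r] has seminorm at most one, and [1 - x = h / r]
    has an approximate root. The given bound is first raised by one to make [r] invertible. *)
Lemma pos_sqrt h e : pos h -> 0 < e ->
  exists k, [/\ sa k, (forall z, GRing.comm z h -> GRing.comm z k) &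
                p (h - k * k) <= e].
Proof.
move=> [sh [r0 r00 hr0]] e0; set r := r0 + 1.
have r_gt0 : 0 < r by rewrite /r; lra.
have hr : p (r%:A - h) <= r by apply: pos_widen hr0 _; rewrite /r; lra.
set x := 1 - r^-1 *: h.
have rx : r *: x = r%:A - h by rewrite scalerBr scalerA divff ?gt_eqF // scale1r.
have px : p x <= 1.
  by rewrite -(ler_pM2l r_gt0) mulr1 -{1}(gtr0_norm r_gt0) -pZ rx.
have sx : sa x by rewrite stB st1 stZ sh.
have [y [sy py cy hy]] := sqrt_approx sx px (divr_gt0 e0 r_gt0).
exists (Num.sqrt r *: (1 - y)); split.
- by rewrite stZ stB st1 sy.
- move=> z zh; have zy : GRing.comm z (1 - y).
    apply: commrB; first exact: commr1.
    apply: cy; apply: commrB; first exact: commr1.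
    by rewrite /GRing.comm -scalerAr -scalerAl zh.
  by rewrite /GRing.comm -scalerAr -scalerAl zy.
rewrite -scalerAl -scalerAr scalerA -expr2 sqr_sqrtr ?(ltW r_gt0) //.
have -> : h - r *: ((1 - y) * (1 - y)) = r *: (1 - x - (1 - y) * (1 - y)).
  rewrite [in RHS]scalerBr scalerBr rx; congr (_ - _).
  by rewrite opprB addrCA subrr addr0.
by rewrite pZ gtr0_norm // mulrC -ler_pdivlMr.
Qed.

(** Up to a small error [e h e] is the square of the self-adjoint [k e], where [k^2] approximates
    [h]. *)
Lemma pos_conj e h : sa e -> GRing.comm e h -> pos h -> pos (e * h * e).
Proof.
move=> se ceh ph; have sh : sa h by case: ph.
split; first by rewrite !stM se sh mulrA.
set s := (p h + 1) * (p e + 1); exists (s ^+ 2); first exact: sqr_ge0.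
have h0 := p_ge0 h; have e0 := p_ge0 e.
have s0 : 0 < s by rewrite /s mulr_gt0 //; lra.
(* The error [e (k^2 - h) e] has seminorm at most [p e ^+ 2 * d'], and [d' <= 1] gives
   [p k ^+ 2 <= p h + 1]. *)
apply/ler_addgt0Pr => d d0; set d' := Num.min 1 (d / (p e ^+ 2 + 1)).
have pe1 : 0 < p e ^+ 2 + 1 by have := sqr_ge0 (p e); lra.
have d'0 : 0 < d' by rewrite lt_min ltr01 divr_gt0.
have [k [sk ck hk]] := pos_sqrt ph d'0.
have cke : k * e = e * k by rewrite ck.
have ske : sa (k * e) by rewrite stM sk se cke.
have pk : p k <= p h + 1.
  rewrite -(ler_pXn2r (n := 2)) ?nnegrE ?p_ge0 //; last by lra.
  have : p (k * k) <= p h + p (k * k - h).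
    by rewrite -[in leLHS](subrK h (k * k)) addrC.
  rewrite p_sa // p_distC.
  have : d' <= 1 by rewrite ge_min lexx.
  nra.
have pke : p (k * e) <= s.
  apply: le_trans (pM _ _) _; rewrite /s; apply: ler_pM => //; lra.
have := p_sub_sqr ske s0 pke => h1.
have -> : (s ^+ 2)%:A - e * h * e =
   ((s ^+ 2)%:A - k * e * (k * e)) + e * (k * k - h) * e.
  rewrite {1}cke mulrBr mulrBl !mulrA -(mulrA (e * k)).
  by rewrite addrA subrK.
apply: le_trans (pD _ _) _; apply: lerD => //.
have : p (e * (k * k - h) * e) <= p e * d' * p e.
  apply: le_trans (pM _ _) _; apply: ler_pM => //.
  apply: le_trans (pM _ _) _; apply: ler_pM => //.
  by rewrite p_distC.
move=> h2; apply: le_trans h2 _.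
have : d' * (p e ^+ 2 + 1) <= d by rewrite -ler_pdivlMr // ge_min lexx orbT.
nra.
Qed.

(** The order controls the seminorm: if [k^2] and [l^2] are close to [h] and [m - h], then
    [k^2 + l^2] is close to [m], and it dominates [k^2] in [p]. *)
Lemma pos_p_le h m : 0 <= m -> pos h -> pos (m%:A - h) -> p h <= m.
Proof.
move=> m0 ph pmh; apply/ler_addgt0Pr => d d0.
have d30 : 0 < d / 3 by lra.
have [k [sk ck hk]] := pos_sqrt ph d30.
have [l [sl cl hl]] := pos_sqrt pmh d30.
have kl : GRing.comm k l.
  apply: cl; apply: commrB; first by rewrite /GRing.comm -scalerAr -scalerAl mulr1 mul1r.
  exact/commr_sym/ck.
have h1 := p_sqr_le_sum sk sl kl.
have h2 : p h <= p (h - k * k) + p (k * k) by rewrite -[in leLHS](subrK (k * k) h).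
rewrite (p_sa sk) in h2.
have h3 : p (k * k + l * l) <= m + 2 * (d / 3).
  have -> : k * k + l * l = m%:A - ((h - k * k) + (m%:A - h - l * l)).
    rewrite addrACA [h + _]addrC subrK -opprD.
    by rewrite opprB addrCA subrr addr0.
  apply: le_trans (pD _ _) _; rewrite pN.
  have := p_scalar m; rewrite ger0_norm //.
  have := pD (h - k * k) (m%:A - h - l * l); lra.
lra.
Qed.

(** Passing from [N] to [N + 1] adds [w^(2N) (1 - w)^2 (1 + w)], a conjugate of the positive element
    [1 + w]. *)
Lemma pos_lower_amplified w N : pos w -> pos (1 - w ^+ N * (1 - w) * w ^+ N).
Proof.
move=> pw; have sw : sa w by case: pw.
have ps1 : pos (1 + w) by apply: posD => //; rewrite -[1]scale1r; apply: pos_scalar.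
elim: N => [|N IHN]; first by rewrite !expr0 mul1r mulr1 opprB addrCA subrr addr0.
pose e := w ^+ N * (1 - w).
have cw n : GRing.comm (w ^+ n) w by apply/commr_sym/commrX.
have ce z : GRing.comm w z -> GRing.comm e z.
  move=> wz; apply/commr_sym/commrM; first exact/commrX/commr_sym.
  by apply: commrB; [exact: commr1 | exact: commr_sym].
have se : sa e.
  rewrite stM stB st1 sw stX //; apply/commr_sym/commrB; first exact: commr1.
  exact: cw.
have ce1 : GRing.comm e (1 + w) by apply: ce; apply: commrD => //; exact: commr1.
suff -> : 1 - w ^+ N.+1 * (1 - w) * w ^+ N.+1 =
    (1 - w ^+ N * (1 - w) * w ^+ N) + e * (1 + w) * e.
  by apply: posD => //; apply: pos_conj.
(* Both sides are polynomials in [w], so the identity is proved in the commutative ring [{poly R}]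
   and then evaluated. *)
have : 1 - 'X ^+ N.+1 * (1 - 'X) * 'X ^+ N.+1 =
    (1 - 'X ^+ N * (1 - 'X) * 'X ^+ N) +
    ('X ^+ N * (1 - 'X)) * (1 + 'X) * ('X ^+ N * (1 - 'X)) :> {poly R}.
  by rewrite exprS; ring.
by move/(congr1 (horner_alg w));
  rewrite !(rmorphD, rmorphN, rmorphM, rmorphXn, rmorph1) /= !horner_algX.
Qed.

(** By the C*-identity [p (w ^+ n)] is log-convex in [n], so its growth ratio, at least [p w] at the
    start, never decreases. *)
Lemma p_exp_growth w n : sa w -> 1 < p w -> p w ^+ n.+1 <= p (w ^+ n.+1) /\
  p w * p (w ^+ n) <= p (w ^+ n.+1).
Proof.
move=> sw w1; have w0 : 0 < p w by lra.
elim: n => [|n [IH1 IH2]].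
  by rewrite !expr1 expr0; split => //; rewrite -[leRHS]mulr1 ler_wpM2l ?p1_le1 // ltW.
have a_gt0 : 0 < p (w ^+ n.+1) by apply: lt_le_trans IH1; rewrite exprn_gt0.
have logconvex : p (w ^+ n.+1) ^+ 2 <= p (w ^+ n.+2) * p (w ^+ n).
  by rewrite -p_sa ?stX // -exprD addnS -addSn exprD pM.
have step : p w * p (w ^+ n.+1) <= p (w ^+ n.+2).
  rewrite -(ler_pM2r a_gt0) -mulrA -expr2.
  apply: le_trans (_ : p w * (p (w ^+ n.+2) * p (w ^+ n)) <= _).
    by rewrite ler_wpM2l // ltW.
  by rewrite mulrCA ler_wpM2l.
split => //; apply: le_trans step; rewrite exprS ler_wpM2l // ltW.
Qed.

(** For [x = k c] with [k^2] close to [s], the elements [st x * x] and [x * st x] have the same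
    seminorm; the second is [c * st c * k^2], because [k] commutes with [c * st c]. *)
Lemma p_conj_swap c s : pos s -> GRing.comm s (c * st c) ->
  p (st c * s * c) <= p (c * st c * s).
Proof.
move=> ps csc; have pc0 := p_ge0 c; have pcc0 := p_ge0 (c * st c).
apply/ler_addgt0Pr => e e0; set M := p c ^+ 2 + p (c * st c) + 1.
have M0 : 0 < M by rewrite /M; have := sqr_ge0 (p c); lra.
have [k [sk ck hk]] := pos_sqrt ps (divr_gt0 e0 M0).
set d := e / M in hk; have Md : M * d = e by rewrite /d mulrC divfK ?gt_eqF.
have d0 : 0 < d by rewrite divr_gt0.
have kcc : GRing.comm k (c * st c) by apply/commr_sym/ck/commr_sym.
have e1 : p (st c * (k * k) * c) = p (c * st c * (k * k)).
  have -> : st c * (k * k) * c = st (k * c) * (k * c) by rewrite stM sk !mulrA.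
  rewrite pC -p_st -pC stK; congr (p _).
  by rewrite stM sk mulrA -(mulrA k) kcc !mulrA.
have h1 : p (st c * s * c) <= p (st c * (s - k * k) * c) + p (st c * (k * k) * c).
  by rewrite -[in leLHS](subrK (k * k) s) mulrDr mulrDl.
have h2 : p (c * st c * (k * k)) <= p (c * st c * s) + p (c * st c * (s - k * k)).
  rewrite -[in leLHS](subKr s (k * k)) mulrBr.
  by apply: le_trans (pD _ _) _; rewrite pN.
have h3 : p (st c * (s - k * k) * c) <= p c ^+ 2 * d.
  apply: le_trans (pM _ _) _; rewrite expr2 mulrAC ler_wpM2r //.
  by apply: le_trans (pM _ _) _; rewrite p_st ler_wpM2l.
have h4 : p (c * st c * (s - k * k)) <= p (c * st c) * d.
  by apply: le_trans (pM _ _) _; rewrite ler_wpM2l.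
rewrite /M in Md; nra.
Qed.

(* [c c^* + c^* c] is a sum of two squares, hence positive, so an upper bound on
   [c^* c] is a lower bound on [c c^*]; but the two have the same nonzero
   spectrum, so [c^* c] has no large negative part either. *)
Lemma p_sqr_lt_of_le1 c : pos (1 - st c * c) -> p c ^+ 2 < 7.
Proof.
set g := st c * c; set g' := c * st c; set G := p c ^+ 2 => p1g.
rewrite ltNge; apply/negP => G7.
have pg : p g = G by rewrite pC.
have pg' : p g' = G by rewrite /g' -{1}(stK c) pC p_st.
have sg : sa g by rewrite stM stK.
have sg' : sa g' by rewrite stM stK.
have p1g' : pos (1 + g').
  (* Twice the real part of [c] and, up to sign, twice its imaginary part. *)
  pose H := c + st c; pose K := I * (c - st c).
  have sH : sa H by rewrite stD stK addrC.
  have sK : sa K by rewrite stM stB stK stI mulrN -mulNr opprB -Icomm.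
  have HK : H * H + K * K = 2 *: (g + g').
    have -> : K * K = - ((c - st c) * (c - st c)).
      rewrite /K; move: (c - st c) => d.
      by rewrite -mulrA (mulrA d) -Icomm -mulrA mulrA II mulN1r.
    rewrite /H /g /g' !mulrDl !mulrDr !mulNr !mulrN opprK !opprD !opprK.
    rewrite scaler_nat mulr2n addrACA.
    rewrite (addrC (c * c)) -(addrA (c * st c)) addNKr (addrACA (st c * c)) subrr addr0.
    by rewrite [RHS]addrACA addrC.
  have -> : 1 + g' = (1 - g) + 2^-1 *: (H * H + K * K).
    by rewrite HK scalerA mulVf ?pnatr_eq0 // scale1r addrA subrK.
  apply: posD => //; apply: posZ; first by lra.
  by apply: posD; apply: pos_sqr.
set u := G%:A - g; set mu := p u.
have pu : pos u by apply: pos_sub_norm; rewrite ?pg.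
have p1gG : G - 1 <= p (1 - g).
  have : p g <= p 1 + p (1 - g)
    by rewrite -[in leLHS](subKr 1 g); apply: le_trans (pD _ _) _; rewrite pN.
  have := p1_le1; lra.
have mu1 : p (1 - g) <= mu.
  apply: pos_p_le => //; first exact: p_ge0.
  have -> : mu%:A - (1 - g) = (mu%:A - u) + (G - 1)%:A.
    by rewrite scalerBl scale1r /u -addrA !opprB subrKA.
  apply: posD; first by apply: pos_sub_norm => //; case: pu.
  by apply: pos_scalar; lra.
have mu2 : p (1 - g) <= mu - G + 1.
  apply: pos_p_le => //; first by lra.
  have -> : (mu - G + 1)%:A - (1 - g) = mu%:A - u.
    rewrite scalerDl scalerBl scale1r /u !opprB (addrC g (- 1)) addrA addrK.
    by rewrite -addrA (addrC g).
  by apply: pos_sub_norm => //; case: pu.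
pose s := G%:A - g'.
have ps : pos s by apply: pos_sub_norm; rewrite ?pg'.
have s_le : p s <= G + 1.
  apply: pos_p_le => //; first by lra.
  by rewrite scalerDl scale1r /s opprB addrC addrA subrK addrC.
have gu : g * u = st c * s * c.
  rewrite /u /s !mulrBr mulrBl -!scalerAr mulr1 -scalerAl mulr1.
  by rewrite /g /g' !mulrA.
have upper : p (g * u) <= G * (G + 1).
  rewrite gu; apply: le_trans (p_conj_swap ps _) _.
    apply/commr_sym/commrB => //; by rewrite /GRing.comm -scalerAr -scalerAl mulr1 mul1r.
  by apply: le_trans (pM _ _) _; rewrite -/g' pg' ler_wpM2l //; lra.
have lower : mu ^+ 2 <= G * mu + p (g * u).
  rewrite -p_sa; last by case: pu.
  have -> : u * u = G *: u - g * u by rewrite {1}/u mulrBl -scalerAl mul1r.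
  by apply: le_trans (pD _ _) _; rewrite pN pZ ger0_norm //; lra.
(* The bounds on [p (1 - g)] give [mu >= 2 G - 2], while [lower] and [upper] give
   [mu (mu - G) <= G (G + 1)]. Together [G^2 - 7 G + 4 <= 0], which fails for [G >= 7]. *)
nra.
Qed.

(* If [w = 1 - b^* b] had norm [W > 1], then [c = b w^N] would satisfy
   [c^* c = w^(2N) - w^(2N+1) <= 1] while its norm is at least [W^(2N) (W - 1)]. *)
Lemma pos_st_mul b : pos (st b * b).
Proof.
have [b0 a0] : 0 <= p b /\ 0 < p b + 1 by have := p_ge0 b; lra.
(* After rescaling, [p g <= 1], so that [w = 1 - g] is positive. *)
wlog b1 : b {b0 a0} / p b <= 1.
  move=> H; set a := p b + 1 in a0.
  have -> : st b * b = a ^+ 2 *: (st (a^-1 *: b) * (a^-1 *: b)).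
    rewrite stZ -scalerAr -scalerAl !scalerA.
    by rewrite expr2 mulfK ?gt_eqF // divff ?gt_eqF // scale1r.
  apply: posZ; first exact: sqr_ge0.
  apply: H; rewrite pZ gtr0_norm ?invr_gt0 // mulrC ler_pdivrMr // mul1r /a; lra.
set g := st b * b; have sg : sa g by rewrite stM stK.
have pg : p g <= 1.
  by rewrite pC expr2 -[leRHS]mulr1; apply: ler_pM.
set w := 1 - g; have pw : pos w by rewrite /w -[1]scale1r; apply: pos_sub_norm.
have sw : sa w by case: pw.
split => //; exists 1 => //; rewrite scale1r -/w leNgt; apply/negP => w1.
have bound N : p w ^+ (N.+1.*2) * (p w - 1) < 7.
  set c := b * w ^+ N.+1.
  have cc : st c * c = w ^+ N.+1 * (1 - w) * w ^+ N.+1.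
    by rewrite stM stX // /w subKr -/w /c /g !mulrA.
  have := @p_sqr_lt_of_le1 c; rewrite cc => /(_ (pos_lower_amplified _ pw)).
  apply: le_lt_trans; rewrite -pC cc.
  have -> : w ^+ N.+1 * (1 - w) * w ^+ N.+1 = - (w ^+ N.+1.*2.+1 - w ^+ N.+1.*2).
    rewrite mulrBr mulr1 mulrBl opprB -exprSr -!exprD -addnn.
    by rewrite addSn.
  rewrite pN.
  have h : p (w ^+ N.+1.*2.+1) <= p (w ^+ N.+1.*2.+1 - w ^+ N.+1.*2) + p (w ^+ N.+1.*2).
    by rewrite -[in leLHS](subrK (w ^+ N.+1.*2) (w ^+ _)).
  have [_ g1] := p_exp_growth N.+1.*2 sw w1.
  have [g2 _] := p_exp_growth N.*2.+1 sw w1.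
  rewrite -doubleS in g2; nra.
have lin N : N%:R * (p w - 1) <= p w ^+ N.
  elim: N => [|N IHN]; first by rewrite mul0r.
  rewrite -addn1 natrD exprD expr1.
  have : 1 <= p w ^+ N by rewrite exprn_ege1 // ltW.
  nra.
have [k hk] : exists k, 7 / (p w - 1) ^+ 2 < k%:R :> R.
  exists (Num.bound (7 / (p w - 1) ^+ 2)).
  by apply: le_lt_trans (archi_boundP _); rewrite ?ler_norm // divr_ge0 ?sqr_ge0.
have d0 : 0 < (p w - 1) ^+ 2 by rewrite exprn_gt0 // subr_gt0.
rewrite ltr_pdivrMr // in hk.
have := bound k; have := lin k.+1.*2.
have : k%:R <= k.+1.*2%:R :> R.
  by rewrite ler_nat -addnn; apply: leq_trans (leqnSn _) (leq_addr _ _).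
nra.
Qed.

(** With [m] the right-hand side, [m - st b * b] is the sum of two positive elements,
    [m - (st b * b + st c * c)] and [st c * c]. *)
Lemma p_le_add_st_mul b c : p (st b * b) <= p (st b * b + st c * c).
Proof.
apply: pos_p_le; [exact: p_ge0 | exact: pos_st_mul |].
rewrite -[X in _ - X](addrK (st c * c)) opprB addrCA addrC.
apply: posD; last exact: pos_st_mul.
by apply: pos_sub_norm => //; rewrite stD !stM !stK.
Qed.

End UnitalCstarSeminorm.

(** * Unitization *)

Section StarAlgebra.
Variables (R : realType) (A : lmodType R[i]) (mul : A -> A -> A) (star : A -> A).
Hypothesis hA : star_algebra mul star.

Lemma sa_mulA a b c : mul a (mul b c) = mul (mul a b) c. Proof. by case: hA. Qed.
Lemma sa_mulDr a b c : mul a (b + c) = mul a b + mul a c. Proof. by case: hA. Qed.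
Lemma sa_mulDl a b c : mul (a + b) c = mul a c + mul b c. Proof. by case: hA. Qed.
Lemma sa_mulZl (k : R[i]) a b : mul (k *: a) b = k *: mul a b.
Proof. by case: hA => _ _ _ h _; case: (h k a b). Qed.
Lemma sa_mulZr (k : R[i]) a b : mul a (k *: b) = k *: mul a b.
Proof. by case: hA => _ _ _ h _; case: (h k a b). Qed.
Lemma sa_starK a : star (star a) = a. Proof. by case: hA => _ _ _ _ []. Qed.
Lemma sa_starD a b : star (a + b) = star a + star b. Proof. by case: hA => _ _ _ _ []. Qed.
Lemma sa_starZ (k : R[i]) a : star (k *: a) = conjc k *: star a.
Proof. by case: hA => _ _ _ _ []. Qed.
Lemma sa_starM a b : star (mul a b) = mul (star b) (star a).
Proof. by case: hA => _ _ _ _ []. Qed.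
Lemma sa_mul0l a : mul 0 a = 0. Proof. by have := sa_mulZl 0 0 a; rewrite !scale0r. Qed.
Lemma sa_mul0r a : mul a 0 = 0. Proof. by have := sa_mulZr 0 a 0; rewrite !scale0r. Qed.
Lemma sa_star0 : star 0 = 0. Proof. by have := sa_starZ 0 0; rewrite rmorph0 !scale0r. Qed.

(* The pair [(k, a)] stands for [k 1 + a]; only the real scalars act. *)
Definition unitization of star_algebra mul star := (R[i] * A)%type.
Local Notation U := (unitization hA).

HB.instance Definition _ := GRing.Zmodule.copy U (R[i] * A)%type.

Definition u_one : U := (1, 0).
Definition u_mul (u v : U) : U := (u.1 * v.1, u.1 *: v.2 + v.1 *: u.2 + mul u.2 v.2).

Lemma u_mulA : associative u_mul.
Proof.
move=> [k a] [l b] [m c]; rewrite /u_mul /=; congr (_, _); first by rewrite mulrA.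
rewrite !scalerDr !sa_mulDr !sa_mulDl !sa_mulZl !sa_mulZr !scalerA sa_mulA !addrA.
rewrite [m * k]mulrC [m * l]mulrC -!addrA; do 2 congr (_ + _).
by rewrite addrCA; congr (_ + _); rewrite [RHS]addrCA; congr (_ + _); rewrite [RHS]addrCA.
Qed.

Lemma u_mul1 : left_id u_one u_mul.
Proof. by move=> [k a]; rewrite /u_mul /= mul1r scale1r scaler0 sa_mul0l !addr0. Qed.

Lemma u_mulr1 : right_id u_one u_mul.
Proof. by move=> [k a]; rewrite /u_mul /= mulr1 scale1r scaler0 sa_mul0r add0r addr0. Qed.

Lemma u_mulDl : left_distributive u_mul +%R.
Proof.
move=> [k a] [l b] [m c]; rewrite /u_mul /=; congr (_, _); first by rewrite mulrDl.
by rewrite scalerDl scalerDr sa_mulDl (addrACA (k *: c)) [LHS]addrACA.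
Qed.

Lemma u_mulDr : right_distributive u_mul +%R.
Proof.
move=> [k a] [l b] [m c]; rewrite /u_mul /=; congr (_, _); first by rewrite mulrDr.
by rewrite scalerDl scalerDr sa_mulDr (addrACA (k *: b)) [LHS]addrACA.
Qed.

Lemma u_one_neq0 : u_one != 0.
Proof. by apply/eqP => -[/eqP]; rewrite oner_eq0. Qed.

HB.instance Definition _ := GRing.Zmodule_isNzRing.Build U
  u_mulA u_mul1 u_mulr1 u_mulDl u_mulDr u_one_neq0.

Definition u_scale (r : R) (u : U) : U := (r%:C * u.1, r%:C *: u.2).

Lemma u_scaleA a b v : u_scale a (u_scale b v) = u_scale (a * b) v.
Proof. by rewrite /u_scale /= mulrA scalerA rmorphM. Qed.

Lemma u_scale1 : left_id 1 u_scale.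
Proof. by move=> [k a]; rewrite /u_scale /= mul1r scale1r. Qed.

Lemma u_scaleDr : right_distributive u_scale +%R.
Proof. by move=> r u v; rewrite /u_scale /= mulrDr scalerDr. Qed.

Lemma u_scaleDl v : {morph u_scale^~ v : a b / a + b}.
Proof. by move=> r s; rewrite /u_scale rmorphD mulrDl scalerDl. Qed.

HB.instance Definition _ := GRing.Zmodule_isLmodule.Build R U
  u_scaleA u_scale1 u_scaleDr u_scaleDl.

Lemma u_scaleAl (k : R) (u v : U) : k *: (u * v) = (k *: u) * v.
Proof.
change (u_scale k (u_mul u v) = u_mul (u_scale k u) v).
rewrite /u_scale /u_mul /=; congr (_, _); first by rewrite mulrA.
by rewrite !scalerDr !scalerA sa_mulZl [k%:C * v.1]mulrC.
Qed.

HB.instance Definition _ := GRing.Lmodule_isLalgebra.Build R U u_scaleAl.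

Lemma u_scaleAr (k : R) (u v : U) : k *: (u * v) = u * (k *: v).
Proof.
change (u_scale k (u_mul u v) = u_mul u (u_scale k v)).
rewrite /u_scale /u_mul /=; congr (_, _); first by rewrite mulrCA.
by rewrite !scalerDr !scalerA sa_mulZr [k%:C * u.1]mulrC.
Qed.

HB.instance Definition _ := GRing.Lalgebra_isAlgebra.Build R U u_scaleAr.

Definition u_star (u : U) : U := (conjc u.1, star u.2).
(** Since the scalar action is real, this central element supplies the imaginary unit, in the role
    of [I]. *)
Definition u_i : U := ('i%C, 0).

Lemma u_starK : involutive u_star.
Proof. by move=> [k a]; rewrite /u_star /= conjcK sa_starK. Qed.

Lemma u_starD u v : u_star (u + v) = u_star u + u_star v.
Proof. by rewrite /u_star /= rmorphD sa_starD. Qed.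

Lemma u_starZ (r : R) u : u_star (r *: u) = r *: u_star u.
Proof.
case: u => k a; congr (_, _); first by rewrite [LHS]rmorphM; congr (_ * _); exact: conjc_real.
by rewrite [LHS]sa_starZ conjc_real.
Qed.

Lemma u_starM u v : u_star (u * v) = u_star v * u_star u.
Proof.
case: u v => [k a] [l b]; congr (_, _); first by rewrite [LHS]rmorphM mulrC.
by rewrite /= !sa_starD !sa_starZ sa_starM; congr (_ + _); exact: addrC.
Qed.

Lemma u_ii : u_i * u_i = - 1.
Proof.
by congr (_, _); [rewrite -sqr_i expr2 |
  rewrite /= !scaler0 sa_mul0l !addr0 oppr0].
Qed.

Lemma u_iC u : u_i * u = u * u_i.
Proof.
by congr (_, _); [exact: mulrC |
  rewrite /= !scaler0 sa_mul0l sa_mul0r !addr0 add0r].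
Qed.

Lemma u_star_i : u_star u_i = - u_i.
Proof.
congr (_, _); last by rewrite /= sa_star0 oppr0.
by apply/eqP; rewrite eq_complex /= oppr0 !eqxx.
Qed.

(** * The operator seminorm on the unitization *)

Variable p : A -> R.
Hypothesis hp : Cstar_seminorm mul star p.

Lemma sem_ge0 a : 0 <= p a. Proof. by case: hp. Qed.
Lemma semD a b : p (a + b) <= p a + p b. Proof. by case: hp. Qed.
Lemma semM a b : p (mul a b) <= p a * p b. Proof. by case: hp. Qed.
Lemma semC a : p (mul (star a) a) = p a ^+ 2. Proof. by case: hp. Qed.
Lemma semZ (k : R[i]) a : p (k *: a) = complex.Re `|k| * p a.
Proof.
have e : `|k| = (complex.Re `|k|)%:C by rewrite normc_def.
by case: hp => _ _ /(_ k a); rewrite {1}e -rmorphM => /(congr1 (@complex.Re R)).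
Qed.
Lemma semZr (r : R) a : p (r%:C *: a) = `|r| * p a.
Proof. by rewrite semZ normc_def /= expr0n addr0 sqrtr_sqr. Qed.
Lemma sem0 : p 0 = 0.
Proof. by have := semZ 0 0; rewrite scale0r normr0 mul0r. Qed.
Lemma semN a : p (- a) = p a.
Proof. by rewrite -scaleN1r -(rmorphN1 (real_complex R)) semZr normrN1 mul1r. Qed.
Lemma sem_star a : p (star a) = p a.
Proof.
have half y : p y <= p (star y).
  have [->|yn0] := eqVneq (p y) 0; first exact: sem_ge0.
  have y0 : 0 < p y by rewrite lt_def yn0 sem_ge0.
  by rewrite -(ler_pM2r y0) -expr2 -semC semM.
by apply/eqP; rewrite eq_le -{2}(sa_starK a) !half.
Qed.

Definition u_act (u : U) x := u.1 *: x + mul u.2 x.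

(** The operator seminorm of left multiplication on [A]; the simpler [|k| + p a] on pairs fails the
    C*-identity in general. *)
Definition u_sem (u : U) : R := sup [set r | exists2 x, p x <= 1 & r = p (u_act u x)].

Lemma u_sem_has_ubound u : has_ubound [set r | exists2 x, p x <= 1 & r = p (u_act u x)].
Proof.
exists (complex.Re `|u.1| + p u.2) => r [x px ->].
apply: le_trans (semD _ _) _; apply: lerD.
  by rewrite semZ -[leRHS]mulr1 ler_wpM2l // normc_def /= sqrtr_ge0.
by apply: le_trans (semM _ _) _; rewrite -[leRHS]mulr1 ler_wpM2l // sem_ge0.
Qed.

Lemma u_sem_le u c : (forall x, p x <= 1 -> p (u_act u x) <= c) -> u_sem u <= c.
Proof.
move=> h; apply: ge_sup; last by move=> r [x px ->]; exact: h.
by exists (p (u_act u 0)); exists 0 => //; rewrite sem0.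
Qed.

Lemma u_actZ (r : R) u x : u_act u (r%:C *: x) = r%:C *: u_act u x.
Proof. by rewrite /u_act sa_mulZr scalerDr !scalerA mulrC. Qed.

Lemma u_semP u x : p (u_act u x) <= u_sem u * p x.
Proof.
have [px0|pxn0] := eqVneq (p x) 0.
  rewrite px0 mulr0; apply: le_trans (semD _ _) _.
  rewrite semZ px0 mulr0 add0r; apply: le_trans (semM _ _) _.
  by rewrite px0 mulr0.
have px0 : 0 < p x by rewrite lt_def pxn0 sem_ge0.
rewrite -ler_pdivrMr // mulrC -{1}[(p x)^-1]gtr0_norm ?invr_gt0 // -semZr -u_actZ.
apply: ub_le_sup; first exact: u_sem_has_ubound.
by exists ((p x)^-1%:C *: x) => //; rewrite semZr gtr0_norm ?invr_gt0 // mulVf.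
Qed.

Lemma u_sem_ge0 u : 0 <= u_sem u.
Proof.
apply: le_trans (sem_ge0 (u_act u 0)) _; apply: ub_le_sup; first exact: u_sem_has_ubound.
by exists 0 => //; rewrite sem0.
Qed.

Lemma u_semP1 u x : p x <= 1 -> p (u_act u x) <= u_sem u.
Proof.
by move=> px; apply: le_trans (u_semP _ _) _; rewrite -[leRHS]mulr1 ler_wpM2l // u_sem_ge0.
Qed.

Lemma u_semD u v : u_sem (u + v) <= u_sem u + u_sem v.
Proof.
apply: u_sem_le => x px.
have -> : u_act (u + v) x = u_act u x + u_act v x.
  by rewrite /u_act /= scalerDl sa_mulDl addrACA.
by apply: le_trans (semD _ _) _; apply: lerD; apply: u_semP1.
Qed.

Lemma u_actM u v x : u_act (u * v) x = u_act u (u_act v x).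
Proof.
rewrite /u_act /= !sa_mulDl !sa_mulDr !scalerDr !sa_mulZl sa_mulZr sa_mulA scalerA.
by rewrite !addrA; congr (_ + _); rewrite addrAC.
Qed.

Lemma u_semM u v : u_sem (u * v) <= u_sem u * u_sem v.
Proof.
apply: u_sem_le => x px; rewrite u_actM; apply: le_trans (u_semP _ _) _.
by rewrite ler_wpM2l ?u_sem_ge0 // u_semP1.
Qed.

Lemma u_semZ (r : R) u : u_sem (r *: u) = `|r| * u_sem u.
Proof.
have le (s : R) v : u_sem (s *: v) <= `|s| * u_sem v.
  apply: u_sem_le => x px.
  have -> : u_act (s *: v) x = s%:C *: u_act v x.
    by rewrite /u_act /= sa_mulZl scalerDr scalerA.
  by rewrite semZr ler_wpM2l // u_semP1.
apply/eqP; rewrite eq_le le /=.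
have [->|r0] := eqVneq r 0; first by rewrite normr0 mul0r u_sem_ge0.
have r0' : 0 < `|r| by rewrite normr_gt0.
rewrite -ler_pdivlMl // -normfV.
by have := le r^-1 (r *: u); rewrite scalerA mulVf // scale1r.
Qed.

(** For [x] in the unit ball, [p (u x) ^+ 2] is the seminorm of [x^* u^* u x], hence at most that of
    [u^* u]. The converse is submultiplicativity, once [u] and [u^*] are known to have equal
    seminorms. *)
Lemma u_semC u : u_sem (u_star u * u) = u_sem u ^+ 2.
Proof.
have sq v : u_sem v ^+ 2 <= u_sem (u_star v * v).
  rewrite -[leRHS]sqr_sqrtr ?u_sem_ge0 //.
  rewrite ler_pXn2r ?nnegrE ?u_sem_ge0 ?sqrtr_ge0 //.
  apply: u_sem_le => x px.
  rewrite -(ler_pXn2r (n := 2)) ?nnegrE ?sem_ge0 ?sqrtr_ge0 // sqr_sqrtr ?u_sem_ge0 //.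
  rewrite -semC {1}/u_act sa_starD sa_starZ sa_starM sa_mulDl sa_mulZl -sa_mulZr.
  rewrite -sa_mulA -sa_mulDr -[conjc v.1 *: _ + _]/(u_act (u_star v) _) -u_actM.
  apply: le_trans (semM _ _) _; rewrite sem_star -[leRHS]mul1r.
  by apply: ler_pM; rewrite ?sem_ge0 // u_semP1.
have le v : u_sem v <= u_sem (u_star v).
  have [->|vn0] := eqVneq (u_sem v) 0; first exact: u_sem_ge0.
  have v0 : 0 < u_sem v by rewrite lt_def vn0 u_sem_ge0.
  by rewrite -(ler_pM2r v0) -expr2; apply: le_trans (sq v) (u_semM _ _).
apply/eqP; rewrite eq_le sq andbT; apply: le_trans (u_semM _ _) _.
by rewrite expr2 ler_wpM2r ?u_sem_ge0 // -{2}(u_starK u) le.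
Qed.

(** The lower bound comes from testing on [star a]. *)
Lemma u_sem_embed a : u_sem (0, a) = p a.
Proof.
have act x : u_act (0, a) x = mul a x by rewrite /u_act /= scale0r add0r.
apply/eqP; rewrite eq_le; apply/andP; split.
  apply: u_sem_le => x px; rewrite act; apply: le_trans (semM _ _) _.
  by rewrite -[leRHS]mulr1 ler_wpM2l ?sem_ge0.
have [->|an0] := eqVneq (p a) 0; first exact: u_sem_ge0.
have a0 : 0 < p a by rewrite lt_def an0 sem_ge0.
have e : p a * p a = p (u_act (0, a) (star a)).
  by rewrite act -{3}(sa_starK a) semC sem_star expr2.
by rewrite -(ler_pM2r a0) e -(sem_star a) u_semP.
Qed.

Lemma sem_le_add_star_mul b c :
  p (mul (star b) b) <= p (mul (star b) b + mul (star c) c).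
Proof.
have := p_le_add_st_mul u_starK u_starD u_starZ u_starM
  u_sem_ge0 u_semD u_semZ u_semM u_semC u_ii u_iC
  u_star_i (0, b) (0, c).
have e d : u_star (0, d) * (0, d) = (0, mul (star d) d) :> U.
  congr (_, _); first by rewrite /= mulr0.
  by rewrite /= oppr0 -[0 +i* 0]/(0 : R[i]) !scale0r !add0r.
rewrite !e; have -> :
    (0, mul (star b) b) + (0, mul (star c) c) = (0, mul (star b) b + mul (star c) c) :> U.
  by congr (_, _); rewrite /= addr0.
by rewrite !u_sem_embed.
Qed.

End StarAlgebra.

(** * Hilbert modules *)

Section ProCstarAlgebra.
Variables (R : realType) (A : proCstar R).
Local Notation alg := (pc_staralg A).

Lemma pc_Cstar (p : A -> R) : pc_sems p ->
  Cstar_seminorm (@pc_mul R A) (@pc_star R A) p.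
Proof. by move=> /pc_semsP[]. Qed.

(** Bounds the empty family, and gives the net of seminorms a base point. *)
Lemma pc_sems_zero : pc_sems (fun _ : A => 0 : R).
Proof.
apply/pc_semsP; split.
  split=> // [a b|k a|a b|a]; rewrite ?addr0 ?mulr0 ?expr0n //.
by move=> x e e0; exists [::], 1; split=> // y _; rewrite subrr normr0.
Qed.

(** Makes [pc_sems] directed, so that one seminorm can stand for a finite family. *)
Lemma pc_sems_max (p q : A -> R) : pc_sems p -> pc_sems q ->
  pc_sems (fun a => Num.max (p a) (q a)).
Proof.
move=> sp sq; have [hp cp] := (pc_semsP p).1 sp; have [hq cq] := (pc_semsP q).1 sq.
apply/pc_semsP; split.
  split=> [a|a b|k a|a b|a].
  - by rewrite le_max (sem_ge0 hp).
  - rewrite ge_max; apply/andP; split.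
      by apply: le_trans (semD hp a b) _; apply: lerD; rewrite le_max lexx.
    by apply: le_trans (semD hq a b) _; apply: lerD; rewrite le_max lexx orbT.
  - have e : `|k| = (complex.Re `|k|)%:C by rewrite normc_def.
    rewrite (semZ hp) (semZ hq) -maxr_pMr; last by rewrite normc_def /= sqrtr_ge0.
    by rewrite {2}e -rmorphM.
  - have h0 (c : A) : 0 <= Num.max (p c) (q c) by rewrite le_max (sem_ge0 hp).
    rewrite ge_max; apply/andP; split.
      apply: le_trans (semM hp a b) _.
      by apply: ler_pM; rewrite ?(sem_ge0 hp) // le_max lexx.
    apply: le_trans (semM hq a b) _.
    by apply: ler_pM; rewrite ?(sem_ge0 hq) // le_max lexx orbT.
  - rewrite (semC hp) (semC hq); have p0 := sem_ge0 hp a; have q0 := sem_ge0 hq a.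
    by case: (leP (p a) (q a)) => h; [apply: max_r | apply: max_l];
      rewrite ler_pXn2r ?nnegrE // ltW.
move=> x e e0; have [F [d [hF d0 h1]]] := cp x e e0; have [G [d' [hG d'0 h2]]] := cq x e e0.
exists (F ++ G), (Num.min d d'); split.
- by move=> r /List.in_app_iff[]; [exact: hF | exact: hG].
- by rewrite lt_min d0.
move=> y hy; have {}h1 : `|p y - p x| < e.
  by apply: h1 => r hr; have := hy r (proj2 (List.in_app_iff _ _ _) (or_introl hr));
    rewrite lt_min => /andP[].
have {}h2 : `|q y - q x| < e.
  by apply: h2 => r hr; have := hy r (proj2 (List.in_app_iff _ _ _) (or_intror hr));
    rewrite lt_min => /andP[].
move: h1 h2; rewrite !ltr_norml => /andP[? ?] /andP[? ?].
by apply/andP; split; case: (leP (p y)); case: (leP (p x)); lra.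
Qed.

Lemma positive_scale (r : R) (a : A) : 0 <= r -> positive a -> positive (r%:C *: a).
Proof.
move=> r0 [b ->]; exists ((Num.sqrt r)%:C *: b).
rewrite (sa_starZ alg) (sa_mulZl alg) (sa_mulZr alg) scalerA conjc_real.
by rewrite -rmorphM /= -expr2 sqr_sqrtr.
Qed.

Lemma positive_mul_star (a : A) : positive (pc_mul a (pc_star a)).
Proof. by exists (pc_star a); rewrite (sa_starK alg). Qed.

Lemma sem_le_add (p : A -> R) (a b : A) : pc_sems p -> positive a -> positive b ->
  p a <= p (a + b).
Proof. by move=> hp [c ->] [d ->]; exact: sem_le_add_star_mul alg _ (pc_Cstar hp) _ _. Qed.

End ProCstarAlgebra.

(** * Cauchy-Schwarz inequality and topology of a Hilbert module *)

Section HilbertModule.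
Variables (R : realType) (A : proCstar R) (X : hilbert_module A).
Local Notation alg := (pc_staralg A).
Implicit Types (x y z : X) (a : A).

Lemma ip_addr x y z : hm_ip x (y + z) = hm_ip x y + hm_ip x z.
Proof. by rewrite hm_ip_sym hm_ip_addl (sa_starD alg) -!hm_ip_sym. Qed.

Lemma ip_scaler (k : R[i]) x y : hm_ip x (k *: y) = conjc k *: hm_ip x y.
Proof. by rewrite hm_ip_sym hm_ip_scale (sa_starZ alg) -hm_ip_sym. Qed.

Lemma ip_actr a x y : hm_ip x (hm_act a y) = pc_mul (hm_ip x y) (pc_star a).
Proof. by rewrite hm_ip_sym hm_ip_act (sa_starM alg) -hm_ip_sym. Qed.

Lemma ip0l x : hm_ip 0 x = 0.
Proof. by have := hm_ip_scale 0 0 x; rewrite !scale0r. Qed.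

Lemma ipNl x y : hm_ip (- x) y = - hm_ip x y.
Proof. by apply/eqP; rewrite -addr_eq0 -hm_ip_addl addNr ip0l. Qed.

Lemma ipBl x y z : hm_ip (x - y) z = hm_ip x z - hm_ip y z.
Proof. by rewrite hm_ip_addl ipNl. Qed.

Lemma ip0r x : hm_ip x 0 = 0.
Proof. by rewrite hm_ip_sym ip0l (sa_star0 alg). Qed.

Lemma ipNr x y : hm_ip x (- y) = - hm_ip x y.
Proof. by apply/eqP; rewrite -addr_eq0 -ip_addr addNr ip0r. Qed.

Lemma ipBr x y z : hm_ip x (y - z) = hm_ip x y - hm_ip x z.
Proof. by rewrite ip_addr ipNr. Qed.

Lemma ip_inj y z : (forall x, hm_ip x y = hm_ip x z) -> y = z.
Proof.
move=> h; apply/eqP; rewrite -subr_eq0; apply/eqP; apply: hm_ip_def.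
by rewrite ipBr h subrr.
Qed.

Section Seminorm.
Variables (p : A -> R) (sp : pc_sems p).
Let hp := pc_Cstar sp.

Lemma pbar_ge0 x : 0 <= pbar p x. Proof. exact: sqrtr_ge0. Qed.

Lemma pbar_sqr x : pbar p x ^+ 2 = p (hm_ip x x).
Proof. by rewrite sqr_sqrtr // (sem_ge0 hp). Qed.

Lemma pbar0 : pbar p (0 : X) = 0.
Proof. by rewrite /pbar ip0l (sem0 hp) sqrtr0. Qed.

(* Positivity of [<z, z>] for [z = x - m <x, y> y] gives
   [2 m p(a)^2 <= p<x, x> + m^2 p(a)^2 p<y, y>] where [a = <x, y>]. *)
Lemma ip_cauchy_schwarz x y : p (hm_ip x y) <= pbar p x * pbar p y.
Proof.
set a := hm_ip x y; have a0 := sem_ge0 hp a.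
have N0 := pbar_ge0 x; have L0 := pbar_ge0 y.
suff: p a ^+ 2 <= (pbar p x * pbar p y) ^+ 2.
  by rewrite ler_pXn2r // nnegrE ?mulr_ge0.
rewrite exprMn !pbar_sqr; set N := p (hm_ip x x); set L := p (hm_ip y y).
have {}N0 : 0 <= N by exact: (sem_ge0 hp).
have {}L0 : 0 <= L by exact: (sem_ge0 hp).
have key m : 0 <= m -> 2 * m * p a ^+ 2 <= N + m ^+ 2 * (p a ^+ 2 * L).
  move=> m0; pose aa := pc_mul a (pc_star a).
  pose z := x - m%:C *: hm_act a y.
  have ezz : (2 * m)%:C *: aa + hm_ip z z =
      hm_ip x x + (m ^+ 2)%:C *: hm_ip (hm_act a y) (hm_act a y).
    have exy : hm_ip x (hm_act a y) = aa by rewrite ip_actr.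
    have eyx : hm_ip (hm_act a y) x = aa by rewrite hm_ip_act (hm_ip_sym x y).
    rewrite /z ipBl !ipBr !hm_ip_scale !ip_scaler conjc_real exy eyx !scalerA.
    have -> : (2 * m)%:C *: aa = m%:C *: aa + m%:C *: aa.
      by rewrite -scalerDl -rmorphD /= -mulr2n mulr_natl.
    by rewrite -rmorphM -expr2 opprB (addrACA (hm_ip x x)) -opprD [LHS]addrC subrK.
  have h1 : p ((2 * m)%:C *: aa) <= p ((2 * m)%:C *: aa + hm_ip z z).
    apply: sem_le_add => //; last exact: hm_ip_pos.
    by apply: positive_scale; [rewrite mulr_ge0 | exact: positive_mul_star].
  have paa : p aa = p a ^+ 2.
    by rewrite /aa -{1}(sa_starK alg a) (semC hp) (sem_star alg hp).
  rewrite (semZr hp) ger0_norm ?mulr_ge0 // paa in h1.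
  apply: le_trans h1 _; rewrite ezz; apply: le_trans (semD hp _ _) _.
  rewrite lerD2l (semZr hp) ger0_norm ?sqr_ge0 // ler_wpM2l ?sqr_ge0 //.
  rewrite hm_ip_act ip_actr expr2 -mulrA [p a * L]mulrC.
  apply: le_trans (semM hp _ _) _; rewrite ler_wpM2l //.
  by apply: le_trans (semM hp _ _) _; rewrite (sem_star alg hp).
apply/ler_addgt0Pr => e e0.
(* The best [m] is [L^-1]; the shift by [d] covers [L = 0], and its size makes [N * d <= e]. *)
pose d := e / (N + 1).
have Nd : N * d <= e.
  rewrite /d mulrCA -[leRHS]mulr1 ler_wpM2l ?(ltW e0) // ler_pdivrMr ?mul1r; lra.
have d0 : 0 < d by rewrite divr_gt0 //; lra.
have Ld : 0 < L + d by lra.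
have := key (L + d)^-1; rewrite invr_ge0 ltW // => /(_ isT).
set m := (L + d)^-1; have mL : m * (L + d) = 1 by rewrite mulVf ?gt_eqF.
have m0 : 0 < m by rewrite invr_gt0.
set q := p a ^+ 2; have q0 : 0 <= q by exact: sqr_ge0.
have mL1 : m * L <= 1 by nra.
have h2 : m ^+ 2 * (q * L) <= m * q.
  have -> : m ^+ 2 * (q * L) = m * q * (m * L) by ring.
  by rewrite -[leRHS]mulr1 ler_wpM2l // mulr_ge0 // ltW.
move=> h1; have {h1 h2} h3 : m * q <= N by lra.
have : q <= N * (L + d).
  have : (m * q) * (L + d) <= N * (L + d) by rewrite ler_wpM2r // ltW.
  by rewrite mulrAC mL mul1r.
lra.
Qed.

Lemma pbarD x y : pbar p (x + y) <= pbar p x + pbar p y.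
Proof.
have x0 := pbar_ge0 x; have y0 := pbar_ge0 y.
rewrite -(ler_pXn2r (n := 2)) ?nnegrE ?pbar_ge0 ?addr_ge0 // pbar_sqr.
rewrite hm_ip_addl !ip_addr.
have := semD hp (hm_ip x x + hm_ip x y) (hm_ip y x + hm_ip y y).
have := semD hp (hm_ip x x) (hm_ip x y).
have := semD hp (hm_ip y x) (hm_ip y y).
have := ip_cauchy_schwarz x y; have := ip_cauchy_schwarz y x.
rewrite -!pbar_sqr; nra.
Qed.

Lemma pbarZ (r : R) x : pbar p (r%:C *: x) = `|r| * pbar p x.
Proof.
rewrite /pbar hm_ip_scale ip_scaler scalerA conjc_real -rmorphM -expr2.
by rewrite (semZr hp) normrX sqrtrM ?sqr_ge0 // sqrtr_sqr normr_id.
Qed.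

Lemma pbarN x : pbar p (- x) = pbar p x.
Proof. by rewrite -scaleN1r -(rmorphN1 (real_complex R)) pbarZ normrN1 mul1r. Qed.

Lemma pbar_distC x y : pbar p (x - y) = pbar p (y - x).
Proof. by rewrite -pbarN opprB. Qed.

Lemma pbar_dist_le x y z : pbar p (x - z) <= pbar p (x - y) + pbar p (y - z).
Proof. by rewrite -(subrKA y x) pbarD. Qed.

Lemma pbar_act a x : pbar p (hm_act a x) <= p a * pbar p x.
Proof.
have a0 := sem_ge0 hp a; have x0 := pbar_ge0 x.
rewrite -(ler_pXn2r (n := 2)) ?nnegrE ?pbar_ge0 ?mulr_ge0 // exprMn !pbar_sqr.
rewrite hm_ip_act ip_actr expr2 -mulrA [p a * p (hm_ip x x)]mulrC.
apply: le_trans (semM hp _ _) _; rewrite ler_wpM2l //.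
by apply: le_trans (semM hp _ _) _; rewrite (sem_star alg hp).
Qed.

End Seminorm.

Lemma pbar_eq0 x : (forall p, pc_sems p -> pbar p x = 0) -> x = 0.
Proof.
move=> h; apply: hm_ip_def; apply: (pc_hausdorff (p0 := A)) => p sp.
by rewrite -(pbar_sqr sp) h // expr0n.
Qed.

Lemma pbar_mono (p q : A -> R) x : (forall a, p a <= q a) -> pbar p x <= pbar q x.
Proof. by move=> h; apply: ler_wsqrtr. Qed.

(** By directedness one seminorm controls a whole basic neighbourhood; completeness and closedness
    can then be tested on single seminorms. *)
Lemma hm_sems_dominated F : in_family (@hm_sems R A X) F ->
  exists2 p, pc_sems p & forall q, List.In q F -> forall x, q x <= pbar p x.
Proof.
elim: F => [|q F IHF] hF; first by exists (fun=> 0) => //; exact: pc_sems_zero.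
have [p sp pF] : exists2 p, pc_sems p & forall q, List.In q F -> forall x, q x <= pbar p x.
  by apply: IHF => r hr; apply: hF; right.
have [p' sp' eq] := hF q (or_introl erefl).
exists (fun a => Num.max (p a) (p' a)); first exact: pc_sems_max.
move=> r [<-|rF] x.
  by rewrite eq; apply: pbar_mono => a; rewrite le_max lexx orbT.
by apply: le_trans (pF r rF x) _; apply: pbar_mono => a; rewrite le_max lexx.
Qed.

Lemma pbar_complete (D : Type) (le : D -> D -> Prop) (d0 : D) (x : D -> X) :
  (forall d, le d d) -> (forall d1 d2 d3, le d1 d2 -> le d2 d3 -> le d1 d3) ->
  (forall d1 d2, exists d3, le d1 d3 /\ le d2 d3) ->
  (forall (p : A -> R) e, pc_sems p -> 0 < e -> exists d1,
     forall d2 d3, le d1 d2 -> le d1 d3 -> pbar p (x d3 - x d2) < e) ->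
  exists l : X, forall (p : A -> R) e, pc_sems p -> 0 < e ->
    exists d1, forall d2, le d1 d2 -> pbar p (x d2 - l) < e.
Proof.
move=> hr ht hd hc; have [|l hl] := hm_complete d0 (x := x) hr ht hd.
  move=> F e hF e0; have [p sp pF] := hm_sems_dominated hF.
  have [d1 hd1] := hc p e sp e0; exists d1 => d2 d3 h2 h3 q qF.
  exact: le_lt_trans (pF q qF _) (hd1 _ _ h2 h3).
exists l => p e sp e0; have [|d1 hd1] := hl [:: pbar p] e _ e0.
  by move=> q [<-|[]]; exists p.
by exists d1 => d2 h2; apply: hd1 => //; left.
Qed.

Lemma gen_closedP (M : X -> Prop) : gen_closed (@hm_sems R A X) M <->
  (forall y, (forall (p : A -> R) e, pc_sems p -> 0 < e ->
     exists2 z, M z & pbar p (z - y) < e) -> M y).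
Proof.
split=> hM y hy; apply: hM.
  move=> F e hF e0; have [p sp pF] := hm_sems_dominated hF.
  by have [z Mz hz] := hy p e sp e0; exists z => // q qF; exact: le_lt_trans (pF q qF _) hz.
move=> p e sp e0; have [|z Mz hz] := hy [:: pbar p] e _ e0.
  by move=> q [<-|[]]; exists p.
by exists z => //; apply: hz; left.
Qed.

Lemma submoduleN (M : X -> Prop) x : submodule M -> M x -> M (- x).
Proof. by move=> [_ _ hZ _] Mx; rewrite -scaleN1r; exact: hZ. Qed.

Lemma submoduleB (M : X -> Prop) x y : submodule M -> M x -> M y -> M (x - y).
Proof. by move=> hM Mx My; case: (hM) => _ hD _ _; apply: hD => //; exact: submoduleN. Qed.

End HilbertModule.

Lemma geometric_small (R : realType) (q C e : R) : 0 <= q < 1 -> 0 <= C -> 0 < e ->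
  exists n, q ^+ n * C < e.
Proof.
move=> /andP[q0 q1] C0 e0.
(* Bernoulli's bound [q^-n >= 1 + n (1 - q)], multiplied out so as to include [q = 0]. *)
have bern n : q ^+ n * (1 + n%:R * (1 - q)) <= 1.
  elim: n => [|n IHn]; first by rewrite expr0 mul0r addr0 mulr1.
  apply: le_trans IHn; rewrite exprSr -mulrA ler_wpM2l ?exprn_ge0 //.
  by have := mulr_ge0 (ler0n R n.+1) (sqr_ge0 (1 - q)); rewrite -natr1; nra.
have [n hn] : exists n, C / (e * (1 - q)) < n%:R :> R.
  exists (Num.bound (C / (e * (1 - q)))).
  by apply: le_lt_trans (archi_boundP _); rewrite ?ler_norm // divr_ge0 // mulr_ge0 //; lra.
exists n; rewrite ltr_pdivrMr in hn; last by rewrite mulr_gt0 //; lra.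
have qn := exprn_ge0 n q0; have := bern n => hb.
have [qn0|qn0] := eqVneq (q ^+ n) 0; first by rewrite qn0 mul0r.
have {}qn0 : 0 < q ^+ n by rewrite lt_def qn0.
have : q ^+ n * C < q ^+ n * (n%:R * (e * (1 - q))) by rewrite ltr_pM2l.
have : e * (q ^+ n * (1 + n%:R * (1 - q))) <= e * 1 by rewrite ler_wpM2l // ltW.
have : 0 <= e * q ^+ n by rewrite mulr_ge0 // ltW.
nra.
Qed.

(** * Coercive operators on a closed submodule *)

Section LaxMilgram.
Variables (R : realType) (A : proCstar R) (X : hilbert_module A) (M : X -> Prop).
Hypothesis hM : closed_submodule M.
Let subM : submodule M := proj1 hM.

(** Density for one seminorm at a time, because the step size of the continuity method depends on
    [p]. *)
Definition dense_image (p : A -> R) (K : X -> X) :=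
  forall y, M y -> forall e, 0 < e -> exists2 x, M x & pbar p (K x - y) < e.

(** Approximate Neumann iteration: solve [K x] close to [y], then repeat with the residual
    [y - L x], which shrinks by a fixed factor. *)
Lemma dense_image_perturb (p : A -> R) (m : R) (K E L : X -> X) : pc_sems p -> 0 < m ->
  (forall x, L x = K x + E x) -> (forall x y, L (x + y) = L x + L y) ->
  (forall x, M x -> M (L x)) ->
  (forall x, M x -> m * pbar p x <= pbar p (K x)) ->
  (forall x, M x -> pbar p (E x) <= m / 2 * pbar p x) ->
  dense_image p K -> dense_image p L.
Proof.
move=> sp m0 hL LD LM lowK upE dK.
have L0 : L 0 = 0 by apply: (addrI (L 0)); rewrite -LD !addr0.
(* If [K x] is within [pbar p y / 4] of [y], then [pbar p (K x)] is at most [5/4] and [pbar p (E x)]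
   at most [5/8] of [pbar p y]; and [1/4 + 5/8 = 7/8]. *)
have step y : M y -> exists2 x, M x & pbar p (L x - y) <= 7 / 8 * pbar p y.
  move=> My; have y0 := pbar_ge0 p y; have [yy|yn0] := eqVneq (pbar p y) 0.
    exists 0; first by case: subM.
    by rewrite L0 sub0r (pbarN sp) yy; lra.
  have [|x Mx hx] := dK y My (pbar p y / 4); first by rewrite divr_gt0 // lt_def yn0.
  exists x => //; have hK : pbar p (K x) <= pbar p (K x - y) + pbar p y.
    by rewrite -{1}(subrK y (K x)) (pbarD sp).
  have hLx : pbar p (L x - y) <= pbar p (K x - y) + pbar p (E x).
    by rewrite hL addrAC (pbarD sp).
  have := lowK x Mx; have := upE x Mx; nra.
have steps n y : M y -> exists2 x, M x & pbar p (L x - y) <= (7 / 8) ^+ n * pbar p y.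
  elim: n y => [|n IHn] y My.
    exists 0; first by case: subM.
    by rewrite L0 sub0r (pbarN sp) expr0 mul1r.
  have [x Mx hx] := IHn y My.
  have [|x' Mx' hx'] := step (y - L x).
    by apply: submoduleB => //; exact: LM.
  exists (x + x'); first by case: subM => _ hD _ _; exact: hD.
  have -> : L (x + x') - y = L x' - (y - L x) by rewrite LD opprB addrA [L x + _]addrC.
  apply: le_trans hx' _; rewrite (pbar_distC sp) exprS -(mulrA (7 / 8)).
  by rewrite ler_wpM2l //; lra.
move=> y My e e0; have [|n hn] := @geometric_small R (7 / 8) (pbar p y) e _ (pbar_ge0 p y) e0.
  by apply/andP; split; lra.
by have [x Mx hx] := steps n y My; exists x => //; exact: le_lt_trans hx hn.
Qed.

Variable S : X -> X.
Hypotheses (SM : forall x, M x -> M (S x)) (SD : forall x y, S (x + y) = S x + S y)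
  (Sbounded : bounded_map S).
(** The continuity method runs through the operators [S + t] and needs one constant [d] for all of
    them. *)
Hypothesis Scoercive : forall p, pc_sems p -> exists2 d : R, 0 < d &
  forall x (t : R), M x -> 0 <= t ->
    d * pbar p x ^+ 2 <= p (hm_ip (S x) x + t%:C *: hm_ip x x).

Lemma coercive_lower_bound p : pc_sems p -> exists2 d : R, 0 < d &
  forall x (t : R), M x -> 0 <= t -> d * pbar p x <= pbar p (S x + t%:C *: x).
Proof.
move=> sp; have [d d0 hd] := Scoercive sp; exists d => // x t Mx t0.
have x0 := pbar_ge0 p x; have [->|xn0] := eqVneq (pbar p x) 0.
  by rewrite mulr0 pbar_ge0.
rewrite -(ler_pM2r (_ : 0 < pbar p x)); last by rewrite lt_def xn0.
rewrite -mulrA -expr2; apply: le_trans (hd x t Mx t0) _.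
by rewrite -hm_ip_scale -hm_ip_addl; exact: ip_cauchy_schwarz.
Qed.

(* Continuity method along [S + t], from large [t] down to [t = 0]. *)
Lemma coercive_dense_image p : pc_sems p -> dense_image p S.
Proof.
move=> sp; have [d d0 low] := coercive_lower_bound sp; have [c c0 hc] := Sbounded sp.
case: (subM) => M0 MD MZ _.
(* Steps of [d / 2] are what [dense_image_perturb] allows for the lower bound [d], which is the same
   for all [j]. *)
pose K j x := S x + (j%:R * (d / 2))%:C *: x.
have KM j x : M x -> M (K j x) by move=> Mx; apply: MD; [exact: SM | exact: MZ].
have KD j x y : K j (x + y) = K j x + K j y by rewrite /K SD scalerDr addrACA.
have down j : dense_image p (K j.+1) -> dense_image p (K j).
  apply: (dense_image_perturb (m := d) (E := fun x => - (d / 2)%:C *: x)) => // x.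
  - rewrite /K -addrA -scalerDl -rmorphN -rmorphD; congr (_ + _%:C *: _).
    by rewrite -natr1; ring.
  - exact: KM.
  - move=> Mx; rewrite /K; apply: low => //; rewrite mulr_ge0 //; lra.
  - by move=> _; rewrite -rmorphN (pbarZ sp) normrN ger0_norm //; lra.
(* For [t > 2 c] the operator [S] is an admissible perturbation of the scalar [t]. *)
have [n hn] : exists n, (2 * c + 1) / (d / 2) < n%:R :> R.
  exists (Num.bound ((2 * c + 1) / (d / 2))).
  apply: le_lt_trans (archi_boundP _); rewrite ?ler_norm // divr_ge0 //; lra.
rewrite ltr_pdivrMr in hn; last by lra.
have start : dense_image p (K n).
  set t := n%:R * (d / 2) in hn; have t0 : 0 < t by lra.
  apply: (dense_image_perturb (m := t) (K := fun x => t%:C *: x) (E := S)) => // x.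
  - by rewrite addrC.
  - exact: KM.
  - by move=> _; rewrite (pbarZ sp) gtr0_norm.
  - move=> _; apply: le_trans (hc x) _; rewrite ler_wpM2r ?pbar_ge0 //; lra.
  - move=> Mx e e0; exists (t^-1%:C *: x); first exact: MZ.
    by rewrite scalerA -rmorphM divff ?gt_eqF // scale1r subrr pbar0.
have -> : S = K 0.
  by apply: funext => x; rewrite /K mul0r scale0r addr0.
by elim: n start {hn} => [//|n IHn] /down.
Qed.

(** Approximate solutions, indexed by a seminorm and a precision, form a net. The lower bound on [S]
    makes it Cauchy, its limit stays in the closed [M], and [S] is continuous. *)
Lemma coercive_surjective y : M y -> exists2 x, M x & S x = y.
Proof.
move=> My.
have SN x : S (- x) = - S x.
  have S0 : S 0 = 0 by apply: (addrI (S 0)); rewrite -SD !addr0.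
  by apply/eqP; rewrite -addr_eq0 -SD addNr S0.
pose D := ({p : A -> R | pc_sems p} * nat)%type.
pose le (a b : D) := (forall z, sval a.1 z <= sval b.1 z) /\ (a.2 <= b.2)%N.
have /choice[x hx] (a : D) : exists x, M x /\ pbar (sval a.1) (S x - y) < a.2.+1%:R^-1.
  case: a => -[p sp] n /=.
  have [|z Mz hz] := coercive_dense_image sp My (e := n.+1%:R^-1); first by rewrite invr_gt0.
  by exists z.
have small (e : R) : 0 < e -> exists n, n.+1%:R^-1 < e.
  move=> e0; exists (Num.bound e^-1); rewrite invf_plt ?posrE //.
  apply: lt_trans (archi_boundP _) _; rewrite ?ltr_nat // invr_ge0 ltW //.
have resid p (sp : pc_sems p) n a : le (exist _ p sp, n) a ->
    pbar p (S (x a) - y) < n.+1%:R^-1.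
  move=> [h1 h2]; apply: le_lt_trans (pbar_mono _ h1) _.
  apply: lt_le_trans (proj2 (hx a)) _.
  by rewrite lef_pV2 ?posrE // ler_nat ltnS.
have [||||l hl] := pbar_complete (le := le) (x := x) (exist _ _ (pc_sems_zero A), 0%N).
- by move=> a; split.
- move=> a b c [h1 h2] [h3 h4]; split; last exact: leq_trans h4.
  by move=> z; apply: le_trans (h1 z) (h3 z).
- move=> [[p sp] n] [[q sq] m].
  exists (exist _ _ (pc_sems_max sp sq), maxn n m); split; split => /=.
  + by move=> z; rewrite le_max lexx.
  + exact: leq_maxl.
  + by move=> z; rewrite le_max lexx orbT.
  + exact: leq_maxr.
- move=> p e sp e0; have [d d0 low] := coercive_lower_bound sp.
  have [n hn] := small (d * e / 2) (divr_gt0 (mulr_gt0 d0 e0) (ltr0n R 2)).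
  exists (exist _ p sp, n) => a b ha hb.
  have := low (x b - x a) 0 (submoduleB subM (proj1 (hx b)) (proj1 (hx a))) (lexx 0).
  rewrite scale0r addr0 SD SN.
  have := pbar_dist_le sp (S (x b)) y (S (x a)).
  rewrite (pbar_distC sp y); have := resid _ _ _ _ ha; have := resid _ _ _ _ hb.
  move=> h1 h2 h3 h4; rewrite -(ltr_pM2l d0).
  by move: (n.+1%:R^-1) hn h1 h2 => r; lra.
have Ml : M l.
  apply: (gen_closedP M).1 (proj2 hM) _ _ => p e sp e0.
  have [a ha] := hl p e sp e0.
  by exists (x a); [exact: (proj1 (hx a)) | apply: ha; split].
exists l => //; apply/eqP; rewrite -subr_eq0; apply/eqP; apply: pbar_eq0 => p sp.
apply/eqP; rewrite eq_le pbar_ge0 andbT; apply/ler_addgt0Pr => e e0; rewrite add0r.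
have [c c0 hc] := Sbounded sp.
have [n hn] := small (e / 2) (divr_gt0 e0 (ltr0n R 2)).
have c1 : 0 < 2 * (c + 1) by lra.
have [[[q sq] m] hl1] := hl p (e / (2 * (c + 1))) sp (divr_gt0 e0 c1).
(* An index beyond both [(p, n)] and the one given by convergence, so that both estimates hold at
   [x b]. *)
pose b : D := (exist _ _ (pc_sems_max sp sq), maxn n m).
have {}hl1 : pbar p (x b - l) < e / (2 * (c + 1)).
  by apply: hl1; split => /=; [move=> z; rewrite le_max lexx orbT | exact: leq_maxr].
have h2 : pbar p (S (x b) - y) < n.+1%:R^-1.
  by apply: resid; split => /=; [move=> z; rewrite le_max lexx | exact: leq_maxl].
have h3 := pbar_dist_le sp (S l) (S (x b)) y.
have h4 : pbar p (S l - S (x b)) <= c * pbar p (x b - l).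
  by rewrite -SN -SD (pbar_distC sp (x b)); exact: hc.
rewrite ltr_pdivlMr // in hl1; have := pbar_ge0 p (x b - l).
by move: (n.+1%:R^-1) hn h2 => r; nra.
Qed.

End LaxMilgram.

(** * Operators with closed range *)

Section Truncation.
Variables (R : realType) (A : proCstar R) (X : hilbert_module A) (M : X -> Prop).
Hypothesis hM : closed_submodule M.
Local Notation alg := (pc_staralg A).

(* [z = (1 + <y, y>)^-1 y]. *)
Lemma truncation_exists y : M y -> exists2 z, M z & z + hm_act (hm_ip z y) y = y.
Proof.
move=> My; have [M0 MD MZ MA] := proj1 hM.
(* Coercivity replaces the inversion of [1 + <y, y>]: for [S w = w + <w, y> y], the element
   [<S w, w>] is [<w, w>] plus the positive [<w, y> <w, y>^*]. *)
apply: (coercive_surjective hM (S := fun w => w + hm_act (hm_ip w y) y)) => //.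
- by move=> w Mw; apply: MD => //; exact: MA.
- by move=> v w; rewrite hm_ip_addl hm_act_addl addrACA.
- move=> p sp; exists (1 + pbar p y ^+ 2); first by have := sqr_ge0 (pbar p y); lra.
  move=> w; apply: le_trans (pbarD sp _ _) _.
  have := pbar_act sp (hm_ip w y) y; have := ip_cauchy_schwarz sp w y.
  have := pbar_ge0 p y; have := pbar_ge0 p w; nra.
move=> p sp; exists 1 => // w t _ t0; have hp := pc_Cstar sp.
have -> : hm_ip (w + hm_act (hm_ip w y) y) w + t%:C *: hm_ip w w =
    (1 + t)%:C *: hm_ip w w + pc_mul (hm_ip w y) (pc_star (hm_ip w y)).
  rewrite hm_ip_addl hm_ip_act (hm_ip_sym w y) rmorphD scalerDl scale1r.
  by rewrite addrAC.
have t1 : 0 <= 1 + t by lra.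
apply: le_trans (sem_le_add sp (positive_scale t1 (hm_ip_pos w)) (positive_mul_star _)).
rewrite (semZr hp) ger0_norm // -(pbar_sqr sp) ler_wpM2r ?sqr_ge0 //; lra.
Qed.

(** Pairing [z] with the equation gives [b = <z, z> + b b^*] for [b = <z, y>]. Both summands are
    positive, so [q b ^+ 2 <= q b]; the resulting bound is the same for every [q]. *)
Lemma truncation_coef_le1 (q : A -> R) (y z : X) : pc_sems q -> z + hm_act (hm_ip z y) y = y ->
  q (hm_ip z y) <= 1 /\ pbar q z <= 1.
Proof.
move=> sq zy; have hq := pc_Cstar sq; set b := hm_ip z y.
have eb : b = hm_ip z z + pc_mul b (pc_star b) by rewrite -ip_actr -ip_addr zy.
have qbb : q (pc_mul b (pc_star b)) = q b ^+ 2.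
  by rewrite -{1}(sa_starK alg b) (semC hq) (sem_star alg hq).
have h1 : q (pc_mul b (pc_star b)) <= q b.
  by rewrite [in leRHS]eb addrC;
    apply: sem_le_add => //; [exact: positive_mul_star | exact: hm_ip_pos].
have h2 : q (hm_ip z z) <= q b.
  by rewrite [in leRHS]eb;
    apply: sem_le_add => //; [exact: hm_ip_pos | exact: positive_mul_star].
have b0 := sem_ge0 hq b; have z0 := pbar_ge0 q z.
have b1 : q b <= 1 by rewrite leNgt; apply/negP; rewrite qbb in h1; nra.
by split => //; rewrite -(pbar_sqr sq) in h2; nra.
Qed.

End Truncation.

(** * Linearity and boundedness of adjoints *)

Section Adjoint.
Variables (R : realType) (A : proCstar R) (X Y : hilbert_module A).
Variables (T : X -> Y) (Ts : Y -> X).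
Hypothesis adj : is_adjoint T Ts.

Lemma adjoint_sym : is_adjoint Ts T.
Proof. by move=> y x; rewrite hm_ip_sym -adj -hm_ip_sym. Qed.

Lemma adjoint_module_map : module_map Ts.
Proof.
split=> [x y|k x|a x]; apply: ip_inj => z.
- by rewrite -adj !ip_addr !adj.
- by rewrite -adj !ip_scaler adj.
- by rewrite -adj !ip_actr adj.
Qed.

(** By Cauchy-Schwarz on [<T (Ts y), y>], the square of [pbar p (Ts y)] is at most
    [c * pbar p (Ts y) * pbar p y]; one factor cancels. *)
Lemma adjoint_bounded : bounded_map T -> bounded_map Ts.
Proof.
move=> hT p sp; have [c c0 hc] := hT p sp; exists c => // y.
have t0 := pbar_ge0 p (Ts y); have [->|tn0] := eqVneq (pbar p (Ts y)) 0.
  by rewrite mulr_ge0 // pbar_ge0.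
rewrite -(ler_pM2r (_ : 0 < pbar p (Ts y))); last by rewrite lt_def tn0.
rewrite -expr2 (pbar_sqr sp) -adj.
apply: le_trans (ip_cauchy_schwarz sp _ _) _.
by rewrite mulrAC ler_wpM2r ?pbar_ge0.
Qed.

End Adjoint.

(** * The gliding hump series *)

Section GlidingHump.
Variables (R : realType) (A : proCstar R) (Y : hilbert_module A).
Variables (p : A -> R) (sp : pc_sems p) (z : nat -> Y).
Hypothesis z_le1 : forall q k, pc_sems q -> pbar q (z k) <= 1.

Local Notation r k := ((8^-1 : R) ^+ k).

(** The sign of each new term is chosen so that the earlier terms cannot cancel its pairing with
    [z k']. *)
Fixpoint hump k : Y :=
  if k is k'.+1 then
    let w := (r k')%:C *: z k' in
    if p (hm_ip w (z k')) <= p (hm_ip (hump k' + w) (z k')) then hump k' + w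
    else hump k' - w
  else 0.

Lemma r_gt0 k : 0 < r k.
Proof. by rewrite exprn_gt0 ?invr_gt0. Qed.

Lemma hump_large k : r k * pbar p (z k) ^+ 2 <= p (hm_ip (hump k.+1) (z k)).
Proof.
have hp := pc_Cstar sp; set w := (r k)%:C *: z k.
have -> : r k * pbar p (z k) ^+ 2 = p (hm_ip w (z k)).
  by rewrite hm_ip_scale (semZr hp) gtr0_norm ?r_gt0 // (pbar_sqr sp).
rewrite /= -/w; case: ifPn => // /negP h.
(* [2 w] is the difference of the candidates [hump k + w] and [hump k - w]; if the first pairs too
   weakly with [z k], the second pairs strongly. *)
have : p (hm_ip w (z k) + hm_ip w (z k)) <=
    p (hm_ip (hump k + w) (z k)) + p (hm_ip (hump k - w) (z k)).
  have -> : hm_ip w (z k) + hm_ip w (z k) =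
      hm_ip (hump k + w) (z k) - hm_ip (hump k - w) (z k).
    by rewrite hm_ip_addl ipBl opprB addrCA [X in _ + (X - _)]addrC addrK.
  by apply: le_trans (semD hp _ _) _; rewrite (semN hp).
have -> : hm_ip w (z k) + hm_ip w (z k) = 2%:C *: hm_ip w (z k).
  by rewrite rmorph_nat scaler_nat mulr2n.
rewrite (semZr hp) normr_nat.
have {h} : p (hm_ip (hump k + w) (z k)) < p (hm_ip w (z k)) by rewrite ltNge; apply/negP.
lra.
Qed.

Lemma hump_step q k : pc_sems q -> pbar q (hump k.+1 - hump k) <= r k.
Proof.
move=> sq.
have w1 : pbar q ((r k)%:C *: z k) <= r k.
  by rewrite (pbarZ sq) gtr0_norm ?r_gt0 // -[leRHS]mulr1 ler_wpM2l ?z_le1 // ltW ?r_gt0.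
rewrite /=; case: ifP => _; first by rewrite addrAC subrr add0r.
by rewrite addrAC subrr add0r (pbarN sq).
Qed.

(** Telescoping, as [r k = 8 / 7 * (r k - r k.+1)]. *)
Lemma hump_dist q n j : pc_sems q ->
  pbar q (hump (n + j) - hump n) <= 8 / 7 * (r n - r (n + j)).
Proof.
move=> sq; elim: j => [|j IHj]; first by rewrite addn0 !subrr (pbar0 _ sq) mulr0.
apply: le_trans (pbar_dist_le sq _ (hump (n + j)) _) _; rewrite addnS.
have := hump_step (n + j) sq; rewrite [r (n + j).+1]exprS; lra.
Qed.

Lemma hump_cvg : exists l : Y,
  (forall q n, pc_sems q -> pbar q (l - hump n) <= 8 / 7 * r n) /\
  forall M : Y -> Prop, closed_submodule M -> (forall k, M (z k)) -> M l.
Proof.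
have le2 q n j : pc_sems q -> pbar q (hump (n + j) - hump n) <= 8 / 7 * r n.
  by move=> sq; apply: le_trans (hump_dist n j sq) _; have := r_gt0 (n + j); lra.
have [||||l hl] := pbar_complete (le := fun a b => (a <= b)%N) (x := hump) 0%N.
- by [].
- by move=> a b c; exact: leq_trans.
- by move=> a b; exists (maxn a b); rewrite leq_maxl leq_maxr.
- move=> q e sq e0.
  have q01 : 0 <= (8^-1 : R) < 1 by apply/andP; split; lra.
  (* Twice [8 / 7], since two late terms are compared through [hump n]. *)
  have C0 : 0 <= (16 / 7 : R) by lra.
  have [n hn] := geometric_small q01 C0 e0.
  exists n => a b ha hb.
  apply: le_lt_trans (pbar_dist_le sq _ (hump n) _) _.
  rewrite (pbar_distC sq (hump n)) -(subnKC ha) -(subnKC hb).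
  have := le2 q n (a - n)%N sq; have := le2 q n (b - n)%N sq; lra.
exists l; split.
  move=> q n sq; apply/ler_addgt0Pr => e e0; have [m hm] := hl q e sq e0.
  apply: le_trans (pbar_dist_le sq _ (hump (n + m)) _) _.
  have := hm (n + m)%N (leq_addl _ _); rewrite (pbar_distC sq).
  have := le2 q n m sq; lra.
move=> M hM Mz; have [M0 MD MZ _] := proj1 hM.
have Mh k : M (hump k).
  elim: k => [//|k IHk] /=.
  by case: ifP => _; [apply: MD | apply: (submoduleB (proj1 hM))] => //; exact: MZ.
apply: (gen_closedP M).1 (proj2 hM) _ _ => q e sq e0; have [m hm] := hl q e sq e0.
by exists (hump m) => //; exact: hm.
Qed.

End GlidingHump.

(** * Closed range and the generalized inverse *)

Section ClosedRange.
Variables (R : realType) (A : proCstar R) (X Y : hilbert_module A).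
Variables (T : X -> Y) (Ts : Y -> X).
Hypotheses (Tmod : module_map T) (Tbounded : bounded_map T) (adj : is_adjoint T Ts).

Lemma ran_submodule : submodule (ran T).
Proof.
case: Tmod => TD TZ TA; split.
- by exists 0; have := TZ 0 0; rewrite !scale0r.
- by move=> _ _ [x ->] [y ->]; exists (x + y).
- by move=> k _ [x ->]; exists (k *: x).
- by move=> a _ [x ->]; exists (hm_act a x).
Qed.

Hypothesis ran_closed : closed_submodule (ran T).

(* Uniform boundedness of the functionals [<., z>], [z] in [ran T], which are
   bounded by [pbar p (Ts z)] at each point of [ran T].  The open mapping theorem
   is not available as the topology need not be metrizable; instead the vectors
   [z] are truncated so as to be bounded for all seminorms at once. *)
Lemma adjoint_lower_bound p : pc_sems p ->
  exists2 d : R, 0 < d & forall y, ran T y -> d * pbar p y <= pbar p (Ts y).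
Proof.
move=> sp; have hp := pc_Cstar sp; apply: contrapT => H.
have [TsD TsZ TsA] := adjoint_module_map adj.
have [_ _ ranZ _] := proj1 ran_closed.
have /choice[z hz] (k : nat) : exists z, [/\ ran T z, (forall q, pc_sems q -> pbar q z <= 1),
    1 / 2 <= pbar p z & pbar p (Ts z) <= (8^-1 ^+ k) ^+ 2].
  (* Half the target: truncation subtracts [<z, y> Ts y], whose coefficient is at most one, and so
     at most doubles [pbar p (Ts y)]. *)
  pose d : R := (8^-1 ^+ k) ^+ 2 / 2.
  have d0 : 0 < d by rewrite divr_gt0 ?exprn_gt0 ?invr_gt0.
  have [y0 [ry0 hy0]] : exists y, ran T y /\ pbar p (Ts y) < d * pbar p y.
    apply: contrapT => /forallNP h; apply: H; exists d => // y ry.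
    by rewrite leNgt; apply/negP => hlt; apply: (h y).
  have n0 : 0 < pbar p y0.
    by rewrite -(pmulr_rgt0 _ d0); apply: le_lt_trans hy0; exact: pbar_ge0.
  pose y := (pbar p y0)^-1%:C *: y0; have ry : ran T y by exact: ranZ.
  have ny : pbar p y = 1 by rewrite (pbarZ sp) gtr0_norm ?invr_gt0 // mulVf ?gt_eqF.
  have hy : pbar p (Ts y) <= d.
    by rewrite TsZ (pbarZ sp) gtr0_norm ?invr_gt0 // mulrC ler_pdivrMr // ltW.
  have [z rz zy] := truncation_exists ran_closed ry; exists z.
  have [b1 _] := truncation_coef_le1 sp zy.
  split => //.
  - by move=> q sq; case: (truncation_coef_le1 sq zy).
  (* As [pbar p y = 1], each of the two summands of [y] is at most [pbar p z]. *)
  - have := pbarD sp z (hm_act (hm_ip z y) y); rewrite zy.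
    have := pbar_act sp (hm_ip z y) y; have := ip_cauchy_schwarz sp z y.
    by rewrite ny !mulr1; lra.
  - have -> : Ts z = Ts y - hm_act (hm_ip z y) (Ts y).
      by rewrite -TsA -[in Ts y]zy TsD addrK.
    apply: le_trans (pbarD sp _ _) _; rewrite (pbarN sp).
    have := pbar_act sp (hm_ip z y) (Ts y); have := pbar_ge0 p (Ts y).
    move: hy; rewrite /d; nra.
have z_le1 q k : pc_sems q -> pbar q (z k) <= 1 by case: (hz k) => _ h _ _; exact: h.
have [l [l_dist ranl]] := hump_cvg p z_le1.
have [|x lx] := ranl _ ran_closed; first by move=> k; case: (hz k).
have q0 : 0 < (8^-1 : R) by lra.
have q01 : 0 <= (8^-1 : R) < 1 by apply/andP; split; lra.
(* The pairing of [l = T x] with [z k] is at most [pbar p x * u ^+ 2] for [u = 8^-k]; this [k]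
   brings it below [u / 8]. *)
have [k hk] := geometric_small q01 (pbar_ge0 p x) q0.
have [_ _ zk hTs] := hz k; have zk1 := z_le1 p k sp.
have := hump_large sp z k.
have h1 : p (hm_ip (hump p z k.+1) (z k)) <=
    p (hm_ip l (z k)) + p (hm_ip (l - hump p z k.+1) (z k)).
  have -> : hm_ip (hump p z k.+1) (z k) = hm_ip l (z k) - hm_ip (l - hump p z k.+1) (z k).
    by rewrite ipBl subKr.
  by apply: le_trans (semD hp _ _) _; rewrite (semN hp).
have h2 := ip_cauchy_schwarz sp (l - hump p z k.+1) (z k).
have h3 := l_dist p k.+1 sp.
have h4 : p (hm_ip l (z k)) <= pbar p x * pbar p (Ts (z k)).
  by rewrite lx adj; exact: ip_cauchy_schwarz.
have r0 := r_gt0 R k; have x0 := pbar_ge0 p x.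
rewrite exprS in h3; set u := 8^-1 ^+ k in hk hTs h3 r0 *.
have {}h3 : pbar p (l - hump p z k.+1) * pbar p (z k) <= u / 7 * pbar p (z k).
  by rewrite ler_wpM2r ?pbar_ge0 //; lra.
have {}h4 : p (hm_ip l (z k)) <= u / 8.
  apply: le_trans h4 _.
  have : pbar p x * pbar p (Ts (z k)) <= pbar p x * u ^+ 2 by rewrite ler_wpM2l.
  nra.
(* The hump would force [s^2 <= 1/8 + s/7] for [s = pbar p (z k)], but [s >= 1/2] gives
   [s (s - 1/7) >= 5/28 > 1/8]. *)
have : u * (1 / 8) < u * (pbar p (z k) * (pbar p (z k) - 1 / 7)).
  rewrite ltr_pM2l //; nra.
nra.
Qed.

(** [S] restricts to a bijection of [ran T], and [W] is the inverse of that bijection after the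
    projection [S W]. *)
Lemma closed_range_ginv : exists Td, bounded_ginv T Td.
Proof.
have [TD TZ TA] := Tmod; have [TsD TsZ TsA] := adjoint_module_map adj.
have adj' := adjoint_sym adj; have Tsbounded := adjoint_bounded adj Tbounded.
have ranSub := proj1 ran_closed; have [_ ranD ranZ ranA] := ranSub.
pose S y := T (Ts y).
have ranS y : ran T (S y) by exists (Ts y).
have SD x y : S (x + y) = S x + S y by rewrite /S TsD TD.
have SZ k x : S (k *: x) = k *: S x by rewrite /S TsZ TZ.
have SA a x : S (hm_act a x) = hm_act a (S x) by rewrite /S TsA TA.
have SB x y : S (x - y) = S x - S y by rewrite SD -scaleN1r SZ scaleN1r.
have Ssa x y : hm_ip (S x) y = hm_ip x (S y) by rewrite /S adj adj'.
have Sb : bounded_map S.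
  move=> p sp; have [c c0 hc] := Tbounded sp; have [e e0 he] := Tsbounded p sp.
  exists (c * e); first exact: mulr_ge0.
  by move=> y; apply: le_trans (hc _) _; rewrite -mulrA ler_wpM2l.
have Tssqr p y : pc_sems p -> pbar p (Ts y) ^+ 2 = p (hm_ip (S y) y).
  by move=> sp; rewrite (pbar_sqr sp) /S adj.
have Scoercive p : pc_sems p -> exists2 d : R, 0 < d & forall y (t : R), ran T y -> 0 <= t ->
    d * pbar p y ^+ 2 <= p (hm_ip (S y) y + t%:C *: hm_ip y y).
  move=> sp; have [d d0 hd] := adjoint_lower_bound sp.
  (* [<S y, y> = <Ts y, Ts y>] is positive, so adding [t <y, y>] cannot lower its seminorm. *)
  exists (d ^+ 2); first exact: exprn_gt0.
  move=> y t ry t0; rewrite -exprMn.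
  apply: le_trans (_ : pbar p (Ts y) ^+ 2 <= _).
    by rewrite ler_pXn2r ?nnegrE ?pbar_ge0 ?mulr_ge0 ?pbar_ge0 ?(ltW d0) //; exact: hd.
  rewrite Tssqr //; apply: sem_le_add => //; last exact/positive_scale/hm_ip_pos.
  by rewrite /S adj; exact: hm_ip_pos.
have Ssurj y : ran T y -> exists2 x, ran T x & S x = y.
  by apply: coercive_surjective.
have Ts0 y : S y = 0 -> Ts y = 0.
  by move=> Sy; apply: hm_ip_def; rewrite -adj -/(S y) Sy ip0l.
have Sinj x y : ran T x -> ran T y -> S x = S y -> x = y.
  move=> rx ry Sxy; apply/eqP; rewrite -subr_eq0; apply/eqP.
  have Ts_0 : Ts (x - y) = 0 by apply: Ts0; rewrite SB Sxy subrr.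
  apply: pbar_eq0 => p sp; have [d d0 hd] := adjoint_lower_bound sp.
  have := hd (x - y) (submoduleB ranSub rx ry); rewrite Ts_0 (pbar0 _ sp).
  by rewrite pmulr_rle0 // => h; apply/eqP; rewrite eq_le h pbar_ge0.
(* [S] is inverted twice on the range because [y] may lie outside it, whereas [S y] does not. *)
have /choice[W hW] (y : Y) : exists w, ran T w /\ S (S w) = S y.
  have [v rv Sv] := Ssurj (S y) (ranS y); have [w rw Sw] := Ssurj v rv.
  by exists w; rewrite Sw.
have rW y : ran T (W y) by case: (hW y).
have SSW y : S (S (W y)) = S y by case: (hW y).
(* Uniqueness makes [W] a module map and yields [W (S (W y)) = W y]. *)
have Wuniq y w : ran T w -> S (S w) = S y -> w = W y.
  move=> rw h; have Sw : S w = S (W y) by apply: Sinj => //; rewrite SSW.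
  exact: Sinj.
(* [S (W y)] is the orthogonal projection of [y] on [ran T]. *)
have orth y v : ran T v -> hm_ip (y - S (W y)) v = 0.
  move=> [u ->]; rewrite -adj'; have -> : Ts (y - S (W y)) = 0.
    by apply: Ts0; rewrite SB SSW subrr.
  exact: ip0l.
have proj_ip y v : ran T v -> hm_ip (S (W y)) v = hm_ip y v.
  by move=> rv; apply/esym/eqP; rewrite -subr_eq0 -ipBl orth.
have proj_id y : ran T y -> S (W y) = y.
  by move=> ry; apply: Sinj => //; rewrite SSW.
exists (fun y => Ts (W y)); split.
- split.
  + split=> [x y|k x|a x].
    * by rewrite -(Wuniq (x + y) (W x + W y)) ?TsD ?SD ?SSW //; exact: ranD.
    * by rewrite -(Wuniq (k *: x) (k *: W x)) ?TsZ ?SZ ?SSW //; exact: ranZ.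
    * by rewrite -(Wuniq (hm_act a x) (hm_act a (W x))) ?TsA ?SA ?SSW //; exact: ranA.
  (* With [t = pbar p (Ts (W y))]: [t^2] is at most the product of [pbar p (S (W y)) <= pbar p y]
     and [pbar p (W y) <= t / d]. *)
  + move=> p sp; have [d d0 hd] := adjoint_lower_bound sp.
    exists d^-1; first by rewrite invr_ge0 ltW.
    move=> y; set t := pbar p (Ts (W y)); have t0 : 0 <= t by exact: pbar_ge0.
    have Py : pbar p (S (W y)) <= pbar p y.
      set P := S (W y); have P0 := pbar_ge0 p P; have y0 := pbar_ge0 p y.
      have : pbar p P ^+ 2 <= pbar p y * pbar p P.
        rewrite (pbar_sqr sp) {1}/P proj_ip; [exact: ip_cauchy_schwarz | exact: ranS].
      nra.
    rewrite mulrC ler_pdivlMr //.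
    have h1 := hd (W y) (rW y); rewrite -/t in h1.
    have h2 : t ^+ 2 <= pbar p (S (W y)) * pbar p (W y).
      by rewrite Tssqr //; exact: ip_cauchy_schwarz.
    have w0 := pbar_ge0 p (W y); have s0 := pbar_ge0 p (S (W y)).
    have [->|tn0] := eqVneq t 0; first by rewrite mul0r pbar_ge0.
    have {}t0 : 0 < t by rewrite lt_def tn0.
    rewrite -(ler_pM2r t0) mulrAC -expr2.
    have : d * t ^+ 2 <= d * (pbar p (S (W y)) * pbar p (W y)) by rewrite ler_pM2l.
    have : pbar p (S (W y)) * (d * pbar p (W y)) <= pbar p y * t.
      by apply: ler_pM => //; rewrite mulr_ge0 // ltW.
    lra.
  (* In [<W y, T x>] replace [T x] by [S (W (T x))] and move [S] to the left, where the projection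
     [S (W y)] may be replaced by [y]. *)
  + exists (fun x => W (T x)) => y x.
    have rT : ran T (T x) by exists x.
    by rewrite adj' -{1}(proj_id _ rT) -Ssa proj_ip.
- by move=> x; apply: proj_id; exists x.
- by move=> y; congr (Ts _); exact/esym/Wuniq.
- move=> x y; rewrite -/(S (W x)) -/(S (W y)) -(proj_ip x) //.
  by rewrite hm_ip_sym -(proj_ip y) // -hm_ip_sym.
- move=> x x'; have r1 : ran T (T x) by exists x.
  have r2 : ran T (T x') by exists x'.
  by rewrite adj' -adj -{1}(proj_id _ r2) -Ssa proj_id.
Qed.

End ClosedRange.

(** [T Td] is continuous and fixes the range pointwise, hence fixes every limit of points of the
    range. *)
Lemma ginv_closed_range (R : realType) (A : proCstar R) (X Y : hilbert_module A)
    (T : X -> Y) (Td : Y -> X) :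
  module_map T -> bounded_map T -> bounded_ginv T Td -> closed_submodule (ran T).
Proof.
move=> Tmod Tb [[Tdmod Tdb _] TTdT _ _ _]; split; first exact: ran_submodule.
apply: (gen_closedP _).2 => y hy; exists (Td y).
have [TD TZ _] := Tmod; have [TdD TdZ _] := Tdmod.
apply/eqP; rewrite -subr_eq0; apply/eqP; apply: pbar_eq0 => p sp.
have [c c0 hc] := Tb p sp; have [e e0 he] := Tdb p sp.
apply/eqP; rewrite eq_le pbar_ge0 andbT; apply/ler_addgt0Pr => eps eps0; rewrite add0r.
have ce0 : 0 < 1 + c * e by rewrite ltr_wpDr ?mulr_ge0.
have [_ [x ->] hz] := hy p (eps / (1 + c * e)) sp (divr_gt0 eps0 ce0).
rewrite ltr_pdivlMr // in hz.
have -> : y - T (Td y) = (y - T x) + T (Td (T x - y)).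
  have TN v : T (- v) = - T v by rewrite -scaleN1r TZ scaleN1r.
  have TdN v : Td (- v) = - Td v by rewrite -scaleN1r TdZ scaleN1r.
  by rewrite TdD TdN TD TN TTdT subrKA.
apply: le_trans (pbarD sp _ _) _; rewrite (pbar_distC sp).
have : pbar p (T (Td (T x - y))) <= c * (e * pbar p (T x - y)).
  by apply: le_trans (hc _) _; rewrite ler_wpM2l.
nra.
Qed.

Theorem theorem2p3 (R : realType) (A : proCstar R) (X Y : hilbert_module A)
    (T : X -> Y) (hT : Hom_star T) :
  (exists Td : Y -> X, bounded_ginv T Td) <-> closed_submodule (ran T).
Proof.
case: hT => Tmod Tb [Ts adj]; split=> [[Td hTd]|hran].
  exact: ginv_closed_range hTd.
exact: closed_range_ginv adj hran.
Qed.
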